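(* Let a regular pencil be spanned by quadratic forms $Q_1,Q_2$ on a $(2n+1)$-dimensional $k$-vector space $U$ with $Q_1$ non-degenerate and associated self-adjoint operator $T$, let $f(x)=\prod_{i=1}^{r+1}(x-\alpha_i)^{m_i}$ over $k^s$ with the $\alpha_i$ distinct, and let $J=\mathrm{Pic}^0(C)$ be the generalized Jacobian of the curve $C:y^2=f(x)$. Let $d_1,\ldots,d_{r+1}$ be integers with $0\le d_i\le m_i/2$, and let $a$ be the number of indices $i$ with $d_i=m_i/2$. Then for any field $k'$ containing $k$, $J[2](k')$ acts on $L^T_{\{d_1,\ldots,d_{r+1}\}}(k')$ simply-transitively if $a=0$ and transitively if $a>0$.
   Context: $k$ is a field of characteristic not $2$, $k^s$ a separable closure, $n\ge1$, $U$ a $k$-vector space of dimension $2n+1$, $Q_1,Q_2$ quadratic forms on $U$ over $k$ with associated bilinear forms $b_1,b_2$ and Gram matrices $A_1,A_2$, and $Q_1$ is non-degenerate. $T:U\to U$ is the unique linear operator with $b_2(v,w)=b_1(v,Tw)$ for all $v,w\in U$; it is self-adjoint for $b_1$. Put $f(x)=(-1)^n\det(xA_1-A_2)$, normalised (after scaling the forms) to be monic, so that $f$ is the characteristic polynomial of $T$; $f$ is assumed to split completely over $k^s$. The pencil is regular if all its singular members are simple cones; equivalently, all eigenspaces of $T$ are 1-dimensional. $C$ is the (possibly singular) complete curve with affine equation $y^2=f(x)$. $U_{i,T}$ is the generalized eigenspace of $T$ with eigenvalue $\alpha_i$, and $\perp$ refers to $Q_1$. For a subspace $X$ of $U\otimes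 k'$, $\dim_{i,T}(X)$ is the dimension of the maximal $T$-stable subspace of the intersection of $U_{i,T}$ with the extension of $X$ to a separable closure of $k'$. Define $$L^T_{\{d_1,\ldots,d_{r+1}\}}(k')=\{X\subset U\otimes k' \mid \dim X=n,\ X\subset X^\perp,\ TX\subset X^\perp,\ \dim_{i,T}(X)=d_i\text{ for all }i\}.$$ The action of $J[2]$: let $\mathrm{PO}(U,Q_1)=O(U,Q_1)/(\pm1)$ and let $\mathrm{Stab}(T)$ be the stabilizer of $T$ for the conjugation action. With $L=k[x]/f(x)$ there are isomorphisms of group schemes over $k$: $J[2]\simeq \mathrm{Res}_{L/k}\mu_2/\mu_2\simeq\mathrm{Stab}(T)$, the last one sending the class of $g$ to the class of $g(T)$. $J[2]$ acts through these isomorphisms and the action $X\mapsto gX$ of $\mathrm{Stab}(T)$. The set acted on may be empty over a non-separably-closed field $k'$; (simply-)transitive then means vacuously so. *)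

(* Defs.v *)
From HB Require Import structures.
From mathcomp Require Import all_boot all_order all_algebra all_field.

Set Implicit Arguments.
Unset Strict Implicit.
Unset Printing Implicit Defensive.

Import GRing.Theory.
Local Open Scope ring_scope.

Definition separable_closure (F Fs : fieldType) (i : {rmorphism F -> Fs}) : Prop :=
  (forall x : Fs, exists2 p : {poly F}, separable_poly p & root (map_poly i p) x)
  /\ (forall p : {poly Fs}, separable_poly p -> (1 < size p)%N ->
        exists x : Fs, root p x).

(** ** Pencils of quadratic forms on k^N (row vectors; a matrix M acts by
    [v |-> v *m M], and subspaces are row spaces of matrices) *)

Section QuadraticForms.
Variables (F : fieldType) (N : nat).

Definition polar (Q : 'rV[F]_N -> F) (v w : 'rV[F]_N) : F :=
  Q (v + w) - Q v - Q w.

Definition quadratic_form (Q : 'rV[F]_N -> F) : Prop :=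
  (forall c v, Q (c *: v) = c ^+ 2 * Q v) /\ (forall v, scalar (polar Q v)).

Definition gram (Q : 'rV[F]_N -> F) : 'M[F]_N :=
  \matrix_(i, j) polar Q (delta_mx 0 i) (delta_mx 0 j).

(* A member is a simple cone when the radical of its bilinear form is a line,
   i.e. when the vertex of the quadric is a point.  To be used over a field
   containing the roots of det(xA1 - A2), so that all singular members occur. *)
Definition regular_pencil (A1 A2 : 'M[F]_N) : Prop :=
  forall a b : F, (a, b) != (0, 0) -> \det (a *: A1 + b *: A2) = 0 ->
    \rank (kermx (a *: A1 + b *: A2)) = 1%N.

Definition max_stable_dim (T W : 'M[F]_N) (d : nat) : Prop :=
  exists Y : 'M[F]_N,
    [/\ (Y <= W)%MS, stablemx Y T,
        forall Z : 'M[F]_N, (Z <= W)%MS -> stablemx Z T -> (Z <= Y)%MS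
      & \rank Y = d].

End QuadraticForms.

(* Dividing by the leading coefficient replaces the normalisation of the forms;
   the result is the characteristic polynomial of T. *)
Definition pencil_poly (F : fieldType) (n : nat) (A1 A2 : 'M[F]_(n.*2.+1)) :
    {poly F} :=
  let D := (-1) ^+ n * \det ('X *: map_mx polyC A1 - map_mx polyC A2) in
  (lead_coef D)^-1 *: D.

(* X is in L^T_{d}(F): A and T are the Gram matrix of Q1 and the operator over F,
   i : F -> Fs is a separable closure, and alpha lists the eigenvalues in Fs. *)
Definition in_L (F Fs : fieldType) (i : {rmorphism F -> Fs}) (n : nat)
    (A T : 'M[F]_(n.*2.+1)) (s : nat) (alpha : 'I_s -> Fs) (d : 'I_s -> nat)
    (X : 'M[F]_(n.*2.+1)) : Prop :=
  [/\ \rank X = n,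
      (X <= orthomx idfun A X)%MS,
      (X *m T <= orthomx idfun A X)%MS
    & forall j, max_stable_dim (map_mx i T)
        (geigenspace (map_mx i T) (alpha j) :&: map_mx i X)%MS (d j)].

(** ** Group actions on subsets, up to equivalence, given by their graph *)

Section Actions.
Variables (G E : Type) (inG : G -> Prop) (eqG : G -> G -> Prop).
Variables (oneG : G) (mulG : G -> G -> G).
Variables (inE : E -> Prop) (eqE : E -> E -> Prop) (act : G -> E -> E -> Prop).

Definition is_action : Prop :=
  [/\ forall g x, inG g -> inE x -> exists y, act g x y,
      forall g x y, inG g -> inE x -> act g x y -> inE y,
      forall g g' x x' y y', inG g -> inG g' -> inE x -> inE x' ->
        eqG g g' -> eqE x x' -> act g x y -> act g' x' y' -> eqE y y',
      forall x, inE x -> act oneG x x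
    & forall g h x y z, inG g -> inG h -> inE x ->
        act g x y -> act h y z -> act (mulG h g) x z].

Definition transitive_action : Prop :=
  forall x y, inE x -> inE y -> exists2 g, inG g & act g x y.

Definition simply_transitive_action : Prop :=
  transitive_action /\
  forall g g' x y, inG g -> inG g' -> inE x -> inE y ->
    act g x y -> act g' x y -> eqG g g'.

End Actions.

(** ** Pic^0 of the complete curve C : y^2 = f(x), for f monic of odd degree

    C has exactly one point oo at infinity; it is smooth and rational, and
    C - oo is the spectrum of the domain R = F[x][y]/(y^2 - f).  Effective
    Cartier divisors of C - oo are invertible ideals of R.  A pair (I, m) stands
    for the Cartier divisor [I] + m oo on C; every Cartier divisor is linearly
    equivalent to such a pair.  Since C has a rational point, the group of
    F-points of the Jacobian of C is Pic^0 of C over F. *)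

Section Curve.
Variables (F : fieldType) (f : {poly F}).

Notation R := {poly %/ ('X^2 - f%:P)}.

Definition curve_x (p : {poly F}) : R := qpolyC ('X^2 - f%:P) p.
Definition curve_y : R := in_qpoly ('X^2 - f%:P) 'X.

Definition is_ideal (I : R -> Prop) : Prop :=
  [/\ I 0, forall u v, I u -> I v -> I (u + v) & forall z u, I u -> I (z * u)].

Definition ideal_mul (I J : R -> Prop) (z : R) : Prop :=
  exists2 s : seq (R * R),
    (forall uv, uv \in s -> I uv.1 /\ J uv.2) & z = \sum_(uv <- s) uv.1 * uv.2.

Definition ideal_scale (a : R) (I : R -> Prop) (z : R) : Prop :=
  exists2 u, I u & z = a * u.

Definition ideal_gen2 (a b z : R) : Prop := exists u v : R, z = u * a + v * b.

Definition unit_ideal (z : R) : Prop := True.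

Definition same_ideal (I J : R -> Prop) : Prop := forall z, I z <-> J z.

Definition invertible_ideal (I : R -> Prop) : Prop :=
  is_ideal I /\ exists2 J, is_ideal J &
    exists2 c : R, c != 0 & same_ideal (ideal_mul I J) (ideal_scale c unit_ideal).

(* dim_F (R / I) = d, via a family of d elements inducing a basis of R / I. *)
Definition ideal_codim (I : R -> Prop) (d : nat) : Prop :=
  exists b : 'I_d -> R, forall z : R,
    exists! c : 'rV[F]_d, I (z - \sum_(i < d) (c 0 i)%:P *: b i).

(* Order of the pole at oo of p(x) + q(x) y (0 for the zero function): x has a
   pole of order 2 and y one of order deg f, which is odd, so that there is no
   cancellation between the two terms. *)
Definition pole_order (z : R) : nat :=
  let p := (z : {poly {poly F}})`_0 in
  let q := (z : {poly {poly F}})`_1 in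
  maxn (size p).-1.*2
       (if q == 0 then 0%N else ((size q).-1.*2 + (size f).-1)%N).

Definition divisor : Type := ((R -> Prop) * int)%type.

Definition div_zero : divisor := (unit_ideal, 0).
Definition div_add (D E : divisor) : divisor :=
  (ideal_mul D.1 E.1, D.2 + E.2).

(* div a + D = div b + E for some nonzero a and b *)
Definition lin_equiv (D E : divisor) : Prop :=
  exists a b : R, [/\ a != 0, b != 0,
    same_ideal (ideal_scale a D.1) (ideal_scale b E.1)
    & D.2 - (pole_order a)%:Z = E.2 - (pole_order b)%:Z].

Definition div_deg0 (D : divisor) : Prop :=
  invertible_ideal D.1 /\ exists2 d : nat, ideal_codim D.1 d & d%:Z + D.2 = 0.

(* D represents a class in J[2](F), where J = Pic^0(C). *)
Definition in_J2 (D : divisor) : Prop :=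
  div_deg0 D /\ lin_equiv (div_add D D) div_zero.

(* The isomorphism J[2](F) = mu_2(F[x]/f) / {1, -1}.  A square root e of 1
   corresponds to the class of the degree 0 divisor [(e + 1, y)] - m oo: on a
   separable closure, e is -1 modulo (x - a_i)^m_i for i in a set S and 1
   modulo the other factors, and this is the class of [(g, y)] - (deg g) oo,
   g being the product of the (x - a_i)^m_i for i in S.  When C is smooth, it
   is the class of the sum of the (a_i, 0) - oo for i in S.
   Here (Res_{L/k} mu_2 / mu_2)(F) is mu_2(F[x]/f) / {1, -1}: the norm of -1
   is -1 as deg f is odd, so the norm splits off mu_2 as a direct factor. *)
Definition J2_corresp (D : divisor) (e : {poly %/ f}) : Prop :=
  e ^+ 2 = 1 /\
  exists m : int,
    let De := (ideal_gen2 (curve_x (e : {poly F}) + 1) curve_y, m) in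
    div_deg0 De /\ lin_equiv D De.

End Curve.

(* D . X = Y: the class of D corresponds to the class of e, hence to the class of
   e(T) in Stab(T), which maps X onto Y. *)
Definition J2_act (F : fieldType) (f : {poly F}) (n : nat)
    (T : 'M[F]_(n.*2.+1)) (D : divisor f) (X Y : 'M[F]_(n.*2.+1)) : Prop :=
  exists2 e : {poly %/ f}, J2_corresp D e
    & (Y == X *m horner_mx T (e : {poly F}))%MS.

(* Main.v *)
Require Import Defs.
From mathcomp Require Import all_boot all_order all_algebra all_field.
From mathcomp Require Import ring zify.
From Stdlib Require Import Classical FunctionalExtensionality PropExtensionality.

Set Implicit Arguments.
Unset Strict Implicit.
Unset Printing Implicit Defensive.

Import GRing.Theory.
Local Open Scope ring_scope.

(** Write F for k', f for the characteristic polynomial of T over F, A = F[x]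
    and R = A[y]/(y^2 - f). The theorem is the meeting point of two statements
    about the square roots e of 1 in F[x]/f: up to sign they are the classes in
    J[2](F), and the operators e(T) permute the linear spaces as claimed. The
    roots are constructed over F itself, without Galois descent; a field
    containing the alpha_i serves to compare largest stable subspaces and to read
    off eigenvalues.

    The 2-torsion. A square root e splits f as a product of coprime p and q, with
    e = -1 modulo p and e = 1 modulo q, and gives the ideal (p, y), whose square
    is p R. The degree of f being odd, the two terms of the norm
    s^2 - t^2 f of s + t y have degrees of different parity, so that the order of
    the pole at infinity is the degree of the norm ([curve_norm_lead]). An
    invertible ideal has a norm in A ([invertible_has_norm]), whose degree is the
    degree of the divisor; hence linear equivalence preserves degrees and the
    multiplicity at infinity takes care of itself. Products of roots give sums of
    divisors ([root_split_mul]); a comparison of degrees shows that (p, y) is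
    principal only when e is 1 or -1 ([ramified_principal]). Conversely let
    a I^2 = b R. Then I is its conjugate times an element w of constant norm; the
    constant is a square, again by parity, and Hilbert's Theorem 90 gives a
    multiple of I that is stable under conjugation. Such an ideal is k (p, y)
    with p dividing f, and p is prime to f / p because the ideal has a norm
    ([two_torsion_ideal]).

    The linear spaces. Let b be the bilinear form of Q1 and Y the largest stable
    subspace of X. Over a field containing the alpha_i, regularity makes every
    stable subspace the kernel of a polynomial in T, determined by its dimensions
    in the generalized eigenspaces ([stable_kermxpoly]); so Y is the same for all
    X with the same d_i. Modulo Y, the pair of maps 1 and T on X is a single
    Kronecker block: X is spanned by v, v T, ..., v T^(n1 - 1)
    ([kronecker_chain]). The conditions on X say that b(v, v T^j) vanishes for
    j < 2 n1, and it does not vanish for j = 2 n1 ([isotropic_normal_form]). So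
    perp Y / Y, of odd dimension 2 n1 + 1, is generated by v as a module over
    F[T]. For another X' with generator v' = v u(T) the same conditions make
    u(T)^2 a scalar c on this quotient; taking determinants, c is a square, and u
    divided by a root of c is a square root of 1 on the quotient, which lifts to
    one modulo f. This gives transitivity ([isotropic_transitive]).

    If e(T) preserves X then v e(T) is a multiple of v modulo Y, so e(T) is a
    scalar on perp Y / Y ([isotropic_stabilizer]). When 2 d_i < m_i for all i,
    every alpha_i is an eigenvalue of T on perp Y / Y ([scalar_on_perp]), and e
    is 1 or -1 ([in_L_free]); when 2 d_i = m_i the factor at alpha_i does not
    occur in perp Y / Y and the sign of e there is free. *)

(** * The coordinate ring of the affine curve *)

Lemma monic_factor_neq0 (F : fieldType) (f p q : {poly F}) :
  f \is monic -> f = p * q -> p != 0 /\ q != 0.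
Proof.
by move=> /monic_neq0 + fpq; rewrite fpq mulf_eq0 negb_or => /andP [].
Qed.

Section CurveRing.
Variables (F : fieldType) (f : {poly F}).

Notation A := {poly F}.
Notation R := {poly %/ ('X^2 - f%:P)}.
Notation cx := (@curve_x F f).
Notation y := (@curve_y F f).

Definition xpart (z : R) : A := (z : {poly A})`_0.
Definition ypart (z : R) : A := (z : {poly A})`_1.

Lemma size_curve_modulus : size ('X^2 - f%:P : {poly A}) = 3%N.
Proof.
rewrite size_polyDl ?size_polyXn // size_polyN.
by rewrite (leq_ltn_trans (size_polyC_leq1 _)).
Qed.

Lemma mk_monic_curve : mk_monic ('X^2 - f%:P) = 'X^2 - f%:P :> {poly A}.
Proof.
rewrite /mk_monic size_curve_modulus /= monicE lead_coefDl ?lead_coefXn ?eqxx //.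
by rewrite size_polyN size_polyXn (leq_ltn_trans (size_polyC_leq1 _)).
Qed.

Lemma curve_ext (z w : R) : xpart z = xpart w -> ypart z = ypart w -> z = w.
Proof.
rewrite /xpart /ypart => e0 e1; apply/npolyP => -[|[|i]] //.
by rewrite !big_coef_npoly // mk_monic_curve size_curve_modulus.
Qed.

Lemma curveE (z : R) : (z : {poly A}) = (xpart z)%:P + (ypart z)%:P * 'X.
Proof.
apply/polyP => -[|[|i]]; rewrite coefD coefC coefMX coefC //= ?addr0 ?add0r //.
by rewrite big_coef_npoly // mk_monic_curve size_curve_modulus.
Qed.

Lemma curve_partM (z w : R) :
  (xpart (z * w) = xpart z * xpart w + ypart z * ypart w * f) *
  (ypart (z * w) = xpart z * ypart w + ypart z * xpart w).
Proof.
have E : ((z * w : R) : {poly A}) =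
  (xpart z * xpart w + ypart z * ypart w * f)%:P +
  (xpart z * ypart w + ypart z * xpart w)%:P * 'X.
  rewrite poly_of_qpolyM (curveE z) (curveE w).
  move: (xpart z) (ypart z) (xpart w) (ypart w) => a b c d.
  rewrite mk_monic_curve.
  have -> : (a%:P + b%:P * 'X) * (c%:P + d%:P * 'X) =
    (b * d)%:P * ('X^2 - f%:P) +
    ((a * c + b * d * f)%:P + (a * d + b * c)%:P * 'X) :> {poly A}.
    by rewrite !(polyCD, polyCM); ring.
  have mon : ('X^2 - f%:P : {poly A}) \is monic.
    by rewrite -mk_monic_curve monic_mk_monic.
  rewrite Pdiv.RingMonic.rmodp_addl_mul_small // size_curve_modulus.
  by rewrite addrC size_MXaddC; case: ifP => // _; rewrite !ltnS size_polyC_leq1.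
split; [rewrite [LHS]/xpart | rewrite [LHS]/ypart].
  by rewrite E coefD coefC coefMX /= addr0.
by rewrite E coefD coefC coefMX coefC /= add0r.
Qed.

Lemma curve_partD (z w : R) :
  (xpart (z + w) = xpart z + xpart w) * (ypart (z + w) = ypart z + ypart w).
Proof. by split; rewrite [LHS]coefD. Qed.

Lemma curve_partN (z : R) :
  (xpart (- z) = - xpart z) * (ypart (- z) = - ypart z).
Proof. by split; rewrite [LHS]coefN. Qed.

Lemma curve_partC (p : A) : (xpart (cx p) = p) * (ypart (cx p) = 0).
Proof. by split; rewrite /xpart /ypart coefC. Qed.

Lemma curve_partY : (xpart y = 0) * (ypart y = 1).
Proof.
have E : (y : {poly A}) = 'X.
  apply: qpolyXE; rewrite ?size_curve_modulus //.
  by rewrite -mk_monic_curve monic_mk_monic.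
by split; rewrite /xpart /ypart E coefX.
Qed.

Lemma curve_part1 : (xpart (1 : R) = 1) * (ypart (1 : R) = 0).
Proof. exact: curve_partC. Qed.

Lemma curve_part0 : (xpart (0 : R) = 0) * (ypart (0 : R) = 0).
Proof. by split; rewrite /xpart /ypart !coef0. Qed.

Definition curve_partE :=
  (curve_partM, curve_partD, curve_partN, curve_partC, curve_partY,
   curve_part1, curve_part0).
End CurveRing.

(** * Conjugation, norms and poles *)

Section CurveNorm.
Variables (F : fieldType) (f : {poly F}).
Hypotheses (fmon : f \is monic) (fodd : odd (size f).-1).

Notation A := {poly F}.
Notation R := {poly %/ ('X^2 - f%:P)}.
Notation cx := (@curve_x F f).
Notation y := (@curve_y F f).

Definition curve_conj (z : R) : R := cx (xpart z) - cx (ypart z) * y.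
Definition curve_norm (z : R) : A := xpart z ^+ 2 - ypart z ^+ 2 * f.

Lemma curve_part_conj (z : R) :
  (xpart (curve_conj z) = xpart z) * (ypart (curve_conj z) = - ypart z).
Proof. by split; rewrite !curve_partE; ring. Qed.

Lemma curve_conjM z w : curve_conj (z * w) = curve_conj z * curve_conj w.
Proof. by apply: curve_ext; rewrite !(curve_part_conj, curve_partE); ring. Qed.

Lemma curve_conjD z w : curve_conj (z + w) = curve_conj z + curve_conj w.
Proof. by apply: curve_ext; rewrite !(curve_part_conj, curve_partE); ring. Qed.

Lemma curve_conjK : involutive curve_conj.
Proof. by move=> z; apply: curve_ext; rewrite !curve_part_conj ?opprK. Qed.

Lemma curve_conj_x p : curve_conj (cx p) = cx p.
Proof. by apply: curve_ext; rewrite !(curve_part_conj, curve_partE) ?oppr0. Qed.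

Lemma curve_conj0 : curve_conj 0 = 0.
Proof. by apply: curve_ext; rewrite !(curve_part_conj, curve_partE) ?oppr0. Qed.

Lemma mul_conj z : z * curve_conj z = cx (curve_norm z).
Proof.
by apply: curve_ext; rewrite /curve_norm !(curve_part_conj, curve_partE); ring.
Qed.

Lemma curve_xM p q : cx (p * q) = cx p * cx q.
Proof. exact: rmorphM. Qed.

Lemma curve_xD p q : cx (p + q) = cx p + cx q.
Proof. exact: rmorphD. Qed.

Lemma curve_x0 : cx 0 = 0.
Proof. exact: rmorph0. Qed.

Lemma curve_x1 : cx 1 = 1.
Proof. by []. Qed.

Lemma curve_x_eq0 p : (cx p == 0) = (p == 0).
Proof.
apply/eqP/eqP => [/(congr1 (@xpart _ _))|->]; first by rewrite !curve_partE.
by apply: curve_ext; rewrite !curve_partE.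
Qed.

Lemma curve_y_neq0 : y != 0.
Proof.
apply/eqP => /(congr1 (@ypart _ _)); rewrite !curve_partE => /eqP.
by rewrite oner_eq0.
Qed.

Lemma curve_y2 : y * y = cx f.
Proof. by apply: curve_ext; rewrite !curve_partE; ring. Qed.

Lemma curve_normM z w : curve_norm (z * w) = curve_norm z * curve_norm w.
Proof. by rewrite /curve_norm !curve_partE; ring. Qed.

Lemma curve_norm_x p : curve_norm (cx p) = p ^+ 2.
Proof. by rewrite /curve_norm !curve_partE; ring. Qed.

Lemma curve_norm_y : curve_norm y = - f.
Proof. by rewrite /curve_norm !curve_partE; ring. Qed.

Lemma size_sqr (p : A) : p != 0 -> size (p ^+ 2) = (size p).-1.*2.+1.
Proof.
by move=> p0; rewrite [LHS]polySpred ?expf_neq0 // size_exp muln2.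
Qed.

Lemma size_sqr_mul (q : A) : q != 0 ->
  size (q ^+ 2 * f) = ((size q).-1.*2 + (size f).-1).+1.
Proof.
move=> q0; have f0 := monic_neq0 fmon.
rewrite size_mul ?expf_neq0 // size_sqr //.
by rewrite -[in LHS](prednK (n := size f)) ?size_poly_gt0 // addnS.
Qed.

(** The two terms of the norm have degrees of different parity, so that its
    leading term is the leading term of one of them. *)
Lemma curve_norm_lead z : z != 0 ->
  size (curve_norm z) = (pole_order z).+1 /\
  exists2 s : F, s != 0 &
    lead_coef (curve_norm z) = (- 1) ^+ (pole_order z) * s ^+ 2.
Proof.
move=> z0; rewrite /pole_order -/(xpart z) -/(ypart z) /curve_norm.
have [q0|q0] /= := eqVneq (ypart z) 0.
  have p0 : xpart z != 0.
    by apply: contraNneq z0 => p0; apply/eqP/curve_ext; rewrite !curve_partE.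
  rewrite q0 maxn0 expr0n mul0r subr0 size_sqr //; split=> //.
  exists (lead_coef (xpart z)); first by rewrite lead_coef_eq0.
  by rewrite lead_coef_exp -mul2n exprM sqrrN !expr1n mul1r.
have [p0|p0] := eqVneq (xpart z) 0.
  rewrite p0 expr0n sub0r size_polyN size_sqr_mul // size_poly0 max0n; split=> //.
  exists (lead_coef (ypart z)); first by rewrite lead_coef_eq0.
  rewrite lead_coefN lead_coefM lead_coef_exp (monicP fmon) mulr1.
  by rewrite -signr_odd oddD odd_double fodd expr1 mulN1r.
have [lt|le] := ltnP (size (ypart z ^+ 2 * f)) (size (xpart z ^+ 2)).
  rewrite size_polyDl ?size_polyN // lead_coefDl ?size_polyN //.
  move: lt; rewrite size_sqr // size_sqr_mul // ltnS => lt.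
  rewrite (maxn_idPl _) 1?ltnW //; split=> //.
  exists (lead_coef (xpart z)); first by rewrite lead_coef_eq0.
  by rewrite lead_coef_exp -mul2n exprM sqrrN !expr1n mul1r.
have lt : (size (xpart z ^+ 2)%R < size (ypart z ^+ 2 * f)%R)%N.
  rewrite ltn_neqAle le andbT size_sqr // size_sqr_mul // eqSS.
  apply/eqP => /(congr1 odd); rewrite oddD !odd_double fodd.
  by [].
rewrite addrC size_polyDl ?size_polyN // lead_coefDl ?size_polyN //.
move: lt; rewrite size_sqr // size_sqr_mul // ltnS => lt.
rewrite (maxn_idPr _) 1?ltnW //; split=> //.
exists (lead_coef (ypart z)); first by rewrite lead_coef_eq0.
rewrite lead_coefN lead_coefM lead_coef_exp (monicP fmon) mulr1.
by rewrite -signr_odd oddD odd_double fodd expr1 mulN1r.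
Qed.

Lemma curve_norm_neq0 z : z != 0 -> curve_norm z != 0.
Proof. by case/curve_norm_lead => s _; rewrite -size_poly_gt0 s. Qed.

Lemma pole_orderE z : z != 0 -> pole_order z = (size (curve_norm z)).-1.
Proof. by case/curve_norm_lead => ->. Qed.

Lemma curve_mul_neq0 (z w : R) : z != 0 -> w != 0 -> z * w != 0.
Proof.
move=> /curve_norm_neq0 z0 /curve_norm_neq0 w0; apply: contraTneq z0 => zw0.
have /eqP : curve_norm (z * w) = 0.
  by rewrite zw0 /curve_norm !curve_partE; ring.
by rewrite curve_normM mulf_eq0 (negPf w0) orbF negbK.
Qed.

Lemma curve_mulI (z u v : R) : z != 0 -> z * u = z * v -> u = v.
Proof.
move=> z0 /eqP; rewrite -subr_eq0 -mulrBr => zuv; apply/eqP; rewrite -subr_eq0.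
by apply: contraTT zuv; apply: curve_mul_neq0.
Qed.

Lemma curve_conj_neq0 z : z != 0 -> curve_conj z != 0.
Proof.
by apply: contraNneq => z0; rewrite -[z]curve_conjK z0 curve_conj0.
Qed.

Lemma pole_orderM z w : z != 0 -> w != 0 ->
  @pole_order F f (z * w) = (pole_order z + pole_order w)%N.
Proof.
move=> z0 w0; rewrite !pole_orderE ?curve_mul_neq0 // curve_normM.
have := curve_norm_neq0 z0; have := curve_norm_neq0 w0.
move=> nw nz; rewrite size_mul //.
by rewrite (polySpred nw) (polySpred nz) addSn addnS.
Qed.

Lemma pole_order_x p : p != 0 -> @pole_order F f (cx p) = (size p).-1.*2.
Proof.
by move=> p0; rewrite pole_orderE ?curve_x_eq0 // curve_norm_x size_sqr.
Qed.

Lemma pole_order_y : @pole_order F f y = (size f).-1.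
Proof. by rewrite pole_orderE ?curve_y_neq0 // curve_norm_y size_polyN. Qed.

Lemma dvd_curve_x p z : (exists w, z = cx p * w) <-> p %| xpart z /\ p %| ypart z.
Proof.
split=> [[w ->]|[/dvdpP [a Ea] /dvdpP [b Eb]]].
  by rewrite !curve_partE !mul0r !addr0; split; apply: dvdp_mulr.
exists (cx a + cx b * y).
by apply: curve_ext; rewrite !curve_partE ?Ea ?Eb; ring.
Qed.
End CurveNorm.

(** * Ideals and their norms *)

(** The ideal is an arbitrary predicate, so that an element of least degree is
    found by excluded middle. *)
Lemma poly_ideal_principal (F : fieldType) (P : {poly F} -> Prop) :
  P 0 -> (forall a b, P a -> P b -> P (a + b)) ->
  (forall c a, P a -> P (c * a)) ->
  exists g : {poly F}, forall a, P a <-> g %| a.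
Proof.
move=> P0 PD PM.
have PB a b : P a -> P b -> P (a - b).
  by move=> Pa Pb; rewrite -mulN1r; apply: PD => //; apply: PM.
have [[a [a0 Pa]]|none] := classic (exists a, a != 0 /\ P a); last first.
  exists 0 => a; rewrite dvd0p; split=> [Pa|/eqP ->//].
  by apply/negPn/negP => a0; apply: none; exists a.
have [n] := ubnP (size a); elim: n a a0 Pa => // n IH a a0 Pa lt.
have [[b [b0 Pb ltb]]|min] :=
    classic (exists b, [/\ b != 0, P b & (size b < size a)%N]).
  by apply: (IH b) => //; apply: leq_trans ltb lt.
exists a => b; split=> [Pb|/dvdpP [c ->]]; last exact: PM.
apply/negPn/negP; rewrite /dvdp => r0; apply: min.
exists (b %% a); split; rewrite ?ltn_modp //.
have -> : b %% a = b - (b %/ a) * a by rewrite {2}(divp_eq b a) addrC addKr.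
by apply: PB => //; apply: PM.
Qed.

Section CurveIdeals.
Variables (F : fieldType) (f : {poly F}).
Hypotheses (fmon : f \is monic) (fodd : odd (size f).-1).
Hypothesis two_neq0 : (2%:R : F) != 0.

Notation A := {poly F}.
Notation R := {poly %/ ('X^2 - f%:P)}.
Notation cx := (@curve_x F f).
Notation y := (@curve_y F f).
Notation unit_ideal := (@unit_ideal F f).
Implicit Types (I J K M : R -> Prop) (h p q : A).

Lemma ideal_mul_ind K I J :
  K 0 -> (forall u v, K u -> K v -> K (u + v)) ->
  (forall u v, I u -> J v -> K (u * v)) ->
  forall z, ideal_mul I J z -> K z.
Proof.
move=> K0 KD KM z [s + ->]; elim: s => [|x s IH] sP; first by rewrite big_nil.
rewrite big_cons; apply: KD.
  by have [Ix Jx] := sP x (mem_head x s); apply: KM.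
by apply: IH => uv uvs; apply: sP; rewrite inE uvs orbT.
Qed.

Lemma mem_ideal_mul I J u v : I u -> J v -> ideal_mul I J (u * v).
Proof.
move=> Iu Jv; exists [:: (u, v)]; last by rewrite big_seq1.
by move=> uv; rewrite inE => /eqP ->.
Qed.

Lemma ideal_mul0 I J : ideal_mul I J 0.
Proof. by exists [::]; rewrite ?big_nil. Qed.

Lemma ideal_mulD I J u v :
  ideal_mul I J u -> ideal_mul I J v -> ideal_mul I J (u + v).
Proof.
move=> [s sP ->] [t tP ->]; exists (s ++ t); last by rewrite big_cat.
by move=> uv; rewrite mem_cat => /orP [/sP|/tP].
Qed.

Lemma is_ideal_mul I J : is_ideal I -> is_ideal (ideal_mul I J).
Proof.
move=> [_ _ IM]; split; [exact: ideal_mul0 | exact: ideal_mulD |].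
move=> z u; elim/ideal_mul_ind: u / => [|u v Hu Hv|u v Iu Jv].
- by rewrite mulr0; apply: ideal_mul0.
- by rewrite mulrDr; apply: ideal_mulD.
- by rewrite mulrA; apply: mem_ideal_mul => //; apply: IM.
Qed.

Lemma ideal_scale_unitE a z : ideal_scale a unit_ideal z <-> exists w, z = a * w.
Proof. by split=> [[w _ ->]|[w ->]]; exists w. Qed.

Lemma is_ideal_scale a I : is_ideal I -> is_ideal (ideal_scale a I).
Proof.
move=> [I0 ID IM]; split; first by exists 0; rewrite ?mulr0.
  by move=> _ _ [u Iu ->] [v Iv ->]; exists (u + v); rewrite ?mulrDr //; apply: ID.
by move=> z _ [u Iu ->]; exists (z * u); [apply: IM | rewrite mulrCA].
Qed.

(** The ideal norm of I, up to a constant factor: for I = z R it is the norm of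
    z, and in general its degree is the codimension of I. *)
Definition has_norm I h := h != 0 /\
  same_ideal (ideal_mul I (fun z => I (curve_conj z))) (ideal_scale (cx h) unit_ideal).

Lemma has_norm_dvd I h u v : has_norm I h -> I u -> I v ->
  exists w, u * curve_conj v = cx h * w.
Proof.
move=> [_ H] Iu Iv; apply/ideal_scale_unitE/H/mem_ideal_mul => //.
by rewrite curve_conjK.
Qed.

(** Multiples of h being sums of products of u and conj v with u and v in I, an
    additive property has to be checked on such products only. *)
Lemma has_norm_ind I h (K : R -> Prop) : has_norm I h ->
  K 0 -> (forall u v, K u -> K v -> K (u + v)) ->
  (forall u v, I u -> I v -> K (u * curve_conj v)) ->
  forall z, K (cx h * z).
Proof.
move=> [_ H] K0 KD KM z; apply: (@ideal_mul_ind K) (K0) (KD) _ _ _; last first.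
  by apply/H/ideal_scale_unitE; exists z.
by move=> u v Iu Iv; rewrite -[v]curve_conjK; apply: KM.
Qed.

Lemma has_normP I h : is_ideal I -> h != 0 ->
  (forall u v, I u -> I v -> exists w, u * curve_conj v = cx h * w) ->
  ideal_mul I (fun z => I (curve_conj z)) (cx h) -> has_norm I h.
Proof.
move=> II h0 H1 H2; split=> // z; split.
  move=> zP; apply/ideal_scale_unitE.
  elim/ideal_mul_ind: z / zP => [|u v [w ->] [w' ->]|u v Iu Iv].
  - by exists 0; rewrite mulr0.
  - by exists (w + w'); rewrite mulrDr.
  - by rewrite -[v]curve_conjK; apply: H1.
case/ideal_scale_unitE => w ->; rewrite mulrC.
by case: (@is_ideal_mul I (fun z => I (curve_conj z)) II) => _ _; apply.
Qed.

Lemma has_norm_same I J h : same_ideal I J -> has_norm I h -> has_norm J h.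
Proof.
move=> IJ [h0 H]; split=> // z; rewrite -H; split=> [][s sP ->]; exists s => //.
  by move=> uv /sP [/IJ ? /IJ ?].
by move=> uv /sP [/IJ ? /IJ ?].
Qed.

Lemma has_norm_uniq I h h' : has_norm I h -> has_norm I h' -> h %= h'.
Proof.
move=> [h0 H] [h0' H'].
have dv a b : (forall z, ideal_scale (cx a) unit_ideal z ->
    ideal_scale (cx b) unit_ideal z) -> b %| a.
  move=> ab; have /ab/ideal_scale_unitE : ideal_scale (cx a) unit_ideal (cx a).
    by apply/ideal_scale_unitE; exists 1; rewrite mulr1.
  by case/dvd_curve_x; rewrite !curve_partE.
by rewrite /eqp !dv // => z; rewrite -H' -H || rewrite -H -H'.
Qed.

Lemma has_norm_unit : has_norm unit_ideal 1.
Proof.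
apply: has_normP; rewrite ?oner_neq0 //.
  by move=> u v _ _; exists (u * curve_conj v); rewrite curve_x1 mul1r.
by rewrite curve_x1 -[1]mul1r; apply: mem_ideal_mul.
Qed.

Lemma has_norm_mul I J h h' : is_ideal I ->
  has_norm I h -> has_norm J h' -> has_norm (ideal_mul I J) (h * h').
Proof.
move=> II nI nJ; apply: has_normP; first exact: is_ideal_mul.
- by rewrite mulf_neq0 ?(proj1 nI) ?(proj1 nJ).
- move=> u v uP vP.
  elim/ideal_mul_ind: u / uP => [|u u' [w E] [w' E']|a b Ia Jb].
  + by exists 0; rewrite mul0r mulr0.
  + by exists (w + w'); rewrite mulrDl E E' mulrDr.
  elim/ideal_mul_ind: v / vP => [|v v' [w E] [w' E']|c d Ic Jd].
  + by exists 0; rewrite curve_conj0 !mulr0.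
  + by exists (w + w'); rewrite curve_conjD mulrDr E E' mulrDr.
  have [w E] := has_norm_dvd nI Ia Ic; have [w' E'] := has_norm_dvd nJ Jb Jd.
  by exists (w * w'); rewrite curve_conjM curve_xM mulrACA E E' mulrACA.
rewrite curve_xM -[cx h]mulr1 -[cx h']mulr1.
have D := @ideal_mulD (ideal_mul I J) (fun z => ideal_mul I J (curve_conj z)).
apply: (has_norm_ind (K := fun z => ideal_mul (ideal_mul I J)
  (fun z => ideal_mul I J (curve_conj z)) (z * (cx h' * 1))) nI).
- by rewrite mul0r; apply: ideal_mul0.
- by move=> u v Ku Kv; rewrite mulrDl; apply: D.
move=> a c Ia Ic.
apply: (has_norm_ind (K := fun z => ideal_mul (ideal_mul I J)
  (fun z => ideal_mul I J (curve_conj z)) (_ * z)) nJ).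
- by rewrite mulr0; apply: ideal_mul0.
- by move=> u v Ku Kv; rewrite mulrDr; apply: D.
move=> b d Jb Jd; rewrite mulrACA; apply: mem_ideal_mul.
  exact: mem_ideal_mul.
by rewrite curve_conjM !curve_conjK; apply: mem_ideal_mul.
Qed.

Lemma has_norm_scale a I h : a != 0 -> is_ideal I -> has_norm I h ->
  has_norm (ideal_scale a I) (curve_norm a * h).
Proof.
move=> a0 II nI; apply: has_normP; first exact: is_ideal_scale.
- by rewrite mulf_neq0 ?(proj1 nI) // curve_norm_neq0.
- move=> _ _ [u Iu ->] [v Iv ->]; have [w E] := has_norm_dvd nI Iu Iv.
  by exists w; rewrite curve_conjM mulrACA E mul_conj curve_xM mulrA.
rewrite curve_xM -[cx h]mulr1.
have D := @ideal_mulD (ideal_scale a I) (fun z => ideal_scale a I (curve_conj z)).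
apply: (has_norm_ind (K := fun z => ideal_mul (ideal_scale a I)
  (fun z => ideal_scale a I (curve_conj z)) (_ * z)) nI).
- by rewrite mulr0; apply: ideal_mul0.
- by move=> u v Ku Kv; rewrite mulrDr; apply: D.
move=> u v Iu Iv; rewrite -mul_conj mulrACA; apply: mem_ideal_mul.
  by exists u.
by rewrite curve_conjM !curve_conjK; exists v.
Qed.

(** As 2 is invertible, a conjugation-stable ideal is the sum of its polynomial
    part and its part in A y; both are principal. *)
Lemma conj_stable_ideal M z0 : is_ideal M ->
  (forall z, M z -> M (curve_conj z)) -> M z0 -> z0 != 0 ->
  exists k p : A, [/\ k != 0, p %| f &
    forall z, M z <-> k * p %| xpart z /\ k %| ypart z].
Proof.
move=> [M0 MD MM] Mconj Mz0 z0_neq0.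
have [g gP] : exists g, forall a, M (cx a) <-> g %| a.
  apply: poly_ideal_principal => [|a b Ma Mb|c a Ma].
  - by rewrite curve_x0.
  - by rewrite curve_xD; apply: MD.
  - by rewrite curve_xM; apply: MM.
have [k kP] : exists k, forall a, M (cx a * y) <-> k %| a.
  apply: poly_ideal_principal => [|a b Ma Mb|c a Ma].
  - by rewrite curve_x0 mul0r.
  - by rewrite curve_xD mulrDl; apply: MD.
  - by rewrite curve_xM -mulrA; apply: MM.
have two : cx (2%:R^-1)%:P * (1 + 1) = 1.
  apply: curve_ext; rewrite !curve_partE ?addr0 ?mul0r ?mulr0 ?addr0 //.
  by rewrite -[1 + 1](polyC_natr F 2) -polyCM mulVf.
have Mxy z : M z <-> M (cx (xpart z)) /\ M (cx (ypart z) * y).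
  split=> [Mz|[Mx My]]; last first.
    rewrite (_ : z = cx (xpart z) + cx (ypart z) * y); first exact: MD.
    by apply: curve_ext; rewrite !curve_partE; ring.
  have Mx : M (cx (xpart z)).
    rewrite -[cx _]mul1r -two -mulrA; apply: MM.
    rewrite (_ : _ * _ = z + curve_conj z); first exact/MD/Mconj.
    by apply: curve_ext; rewrite !(curve_part_conj, curve_partE); ring.
  split=> //; rewrite (_ : _ * y = z + (- 1) * cx (xpart z)).
    by apply: MD => //; apply: MM.
  by apply: curve_ext; rewrite !curve_partE; ring.
have kg : k %| g.
  by apply/kP; rewrite mulrC; apply: MM; apply/gP.
have /dvdpP [p Ep] := kg.
have k0 : k != 0.
  apply: contraNneq z0_neq0 => k0; have /Mxy [/gP + /kP] := Mz0.
  rewrite Ep k0 mulr0 !dvd0p => /eqP x0 /eqP y0; apply/eqP.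
  by apply: curve_ext; rewrite !curve_partE.
have gkf : g %| k * f.
  apply/gP; rewrite curve_xM -curve_y2 mulrA mulrC; apply: MM.
  exact/kP.
exists k, p; split=> // [|z]; last by rewrite Mxy gP kP Ep mulrC.
by rewrite -(@dvdp_mul2l _ k) // mulrC -Ep.
Qed.
End CurveIdeals.

(** * The ideals (p, y) *)

Section RamifiedIdeals.
Variables (F : fieldType) (f : {poly F}).
Hypotheses (fmon : f \is monic) (fodd : odd (size f).-1).
Hypothesis two_neq0 : (2%:R : F) != 0.

Notation A := {poly F}.
Notation R := {poly %/ ('X^2 - f%:P)}.
Notation cx := (@curve_x F f).
Notation y := (@curve_y F f).
Notation unit_ideal := (@unit_ideal F f).
Implicit Types (I J K M : R -> Prop) (e h p q : A).

(** Nilpotent elements modulo p are closed under sums. *)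
Lemma dvdp_exprD p a b m l :
  p %| a ^+ m -> p %| b ^+ l -> p %| (a + b) ^+ (m + l).
Proof.
move=> pa pb; rewrite exprDn; elim/big_ind: _ => [|u v|i _].
- exact: dvdp0.
- exact: dvdp_add.
rewrite -mulr_natr; apply: dvdp_mulr; case: (leqP l i) => li.
  by apply: dvdp_mull; apply: dvdp_trans pb _; exact: dvdp_exp2l.
by apply: dvdp_mulr; apply: dvdp_trans pa _; apply: dvdp_exp2l; lia.
Qed.

Lemma has_norm_neq0 I h : has_norm I h -> exists2 u, I u & u != 0.
Proof.
move=> nI; apply: NNPP => none; have [h0 _] := nI.
have : cx h * 1 = 0.
  apply: (has_norm_ind (K := fun z => z = 0) nI) => // [u v -> ->|u v Iu _].
    by rewrite addr0.
  have [->|u0] := eqVneq u 0; first by rewrite mul0r.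
  by case: none; exists u.
by move/eqP; rewrite mulr1 curve_x_eq0 (negPf h0).
Qed.

(** The product of I and its conjugate is stable under conjugation, so it is
    k (p, y) with p dividing f. Let I J = c R and c = sum of u_i v_i, and write
    u_i v_i = c s_i. Then the s_i add up to 1 and s_i I is contained in u_i R:
    where s_i is invertible, u_i generates I. There the product is generated by
    the norm of u_i, and comparing it with k (p, y) shows that p divides the norm
    of s_i, that is xpart s_i ^ 2 modulo p. So 1 is nilpotent modulo p. *)
Lemma invertible_has_norm I : invertible_ideal I -> exists h, has_norm I h.
Proof.
case=> II [J IJ [c c0 cP]]; have [_ _ IM] := II.
pose M := ideal_mul I (fun z => I (curve_conj z)).
have MI : is_ideal M by apply: is_ideal_mul.
have cIJ : ideal_mul I J c.
  by apply/cP/ideal_scale_unitE; exists 1; rewrite mulr1.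
have Mconj z : M z -> M (curve_conj z).
  elim/ideal_mul_ind: z / => [|u v Mu Mv|u v Iu Iv].
  - by rewrite curve_conj0; case: MI.
  - by rewrite curve_conjD; case: MI => _ MD _; apply: MD.
  - by rewrite curve_conjM mulrC; apply: mem_ideal_mul; rewrite ?curve_conjK.
have memM u v : I u -> I v -> M (u * curve_conj v).
  by move=> Iu Iv; apply: mem_ideal_mul; rewrite ?curve_conjK.
have [u0 Iu0 u0_neq0] : exists2 u, I u & u != 0.
  apply: NNPP => none; move/eqP: c0; apply.
  elim/ideal_mul_ind: c / cIJ {cP} => // [u v -> ->|u v Iu _].
    by rewrite addr0.
  have [->|u0] := eqVneq u 0; first by rewrite mul0r.
  by case: none; exists u.
have [k [p [k0 pf MP]]] := conj_stable_ideal two_neq0 MI Mconj (memM _ _ Iu0 Iu0)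
  (curve_mul_neq0 fmon fodd u0_neq0 (curve_conj_neq0 u0_neq0)).
have p1 : p %| 1.
  have : exists2 s, c = c * s & exists l, p %| xpart s ^+ l.
    elim/ideal_mul_ind: {1}c / cIJ => [|u v [s Es [l sl]] [t Et [m tm]]|u v Iu Jv].
    - exists 0; rewrite ?mulr0 //; exists 1%N.
      by rewrite expr1 !curve_partE dvdp0.
    - exists (s + t); first by rewrite mulrDr -Es -Et.
      by exists (l + m)%N; rewrite !curve_partE; apply: dvdp_exprD.
    have [s Es] : exists s, u * v = c * s.
      by apply/ideal_scale_unitE/cP/mem_ideal_mul.
    have st t : I t -> exists r, s * t = u * r.
      move=> It; have [r Er] : exists r, t * v = c * r.
        by apply/ideal_scale_unitE/cP/mem_ideal_mul.
      exists r; apply: (curve_mulI fmon fodd c0).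
      by rewrite mulrA -Es -mulrA [v * t]mulrC Er mulrCA.
    exists s => //; exists 2%N.
    have sM z : M z -> exists w, cx (curve_norm s) * z = cx (curve_norm u) * w.
      elim/ideal_mul_ind: z / => [|z z' [w E] [w' E']|t t' It It'].
      - by exists 0; rewrite !mulr0.
      - by exists (w + w'); rewrite mulrDr E E' -mulrDr.
      have [r Er] := st _ It; have [r' Er'] := st _ It'.
      exists (r * curve_conj r'); rewrite -!mul_conj mulrACA Er.
      have := congr1 (@curve_conj F f) Er'; rewrite !curve_conjM curve_conjK => ->.
      by rewrite mulrACA.
    have Mky : M (cx k * y).
      by apply/MP; rewrite !curve_partE !mul0r !mulr0 addr0 dvdp0 mulr1 addr0 dvdpp.
    have [w Ew] := sM _ Mky.
    have Nk : curve_norm s * k = curve_norm u * ypart w.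
      have := congr1 (@ypart F f) Ew; rewrite !curve_partE.
      by rewrite !(mul0r, mulr0, addr0, mulr1).
    have kpN : k * p %| curve_norm u.
      by have /MP[+ _] := memM u u Iu Iu; rewrite mul_conj curve_partE.
    have pN : p %| curve_norm s.
      by rewrite -(@dvdp_mul2l _ k) // [k * curve_norm s]mulrC Nk dvdp_mulr.
    rewrite -(dvdp_subl (xpart s ^+ 2) (n := ypart s ^+ 2 * f)) //.
    exact: dvdp_mull.
  case=> s Es [l]; suff -> : s = 1 by rewrite !curve_partE expr1n.
  by apply: (curve_mulI fmon fodd c0); rewrite mulr1.
exists k; apply: has_normP => //.
  move=> u v Iu Iv; have /MP [kx ky] := memM _ _ Iu Iv.
  by apply/dvd_curve_x; split=> //; apply: dvdp_trans kx; apply: dvdp_mulr.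
apply/MP; rewrite !curve_partE dvdp0; split=> //.
by rewrite -[X in _ %| X]mulr1 dvdp_mul2l.
Qed.

(** For p dividing f this is the ideal (p, y). *)
Definition ramified_ideal p (z : R) : Prop := p %| xpart z.

(** The ideal (s, y) contains f = y^2, hence the greatest common divisor of s
    and f. *)
Lemma ideal_gen2_gcd s z :
  ideal_gen2 (cx s) y z <-> ramified_ideal (gcdp s f) z.
Proof.
rewrite /ramified_ideal; split=> [[u [v ->]]|].
  rewrite !curve_partE; apply: dvdp_add; apply: dvdp_add.
  - by apply: dvdp_mull; apply: dvdp_gcdl.
  - by rewrite mulr0 mul0r dvdp0.
  - by rewrite mulr0 dvdp0.
  - by apply: dvdp_mull; apply: dvdp_gcdr.
have [[a b] /= ab] := Bezoutp s f; rewrite -(eqp_dvdl _ ab) => /dvdpP [c Ec].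
exists (cx (c * a)), (cx (ypart z) + cx (c * b) * y).
by apply: curve_ext; rewrite !curve_partE ?Ec; ring.
Qed.

Lemma ramified_ideal_ideal p : p %| f -> is_ideal (ramified_ideal p).
Proof.
move=> pf; rewrite /ramified_ideal; split=> [|u v|z u].
- by rewrite !curve_partE dvdp0.
- by rewrite !curve_partE; apply: dvdp_add.
by move=> pu; rewrite !curve_partE; apply: dvdp_add; apply: dvdp_mull.
Qed.

Section Split.
Variables p q : A.
Hypotheses (fpq : f = p * q) (cpq : coprimep p q).

Let p0 : p != 0. Proof. by case: (monic_factor_neq0 fmon fpq). Qed.

Let pf : p %| f. Proof. by rewrite fpq dvdp_mulr. Qed.

(** The ideal (p, y) is its own conjugate, and its square
    (p^2, p y, p q) = p (p, y, q) is p R since p and q are coprime. *)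
Lemma has_norm_ramified : has_norm (ramified_ideal p) p.
Proof.
apply: has_normP => //; first exact: ramified_ideal_ideal.
  rewrite /ramified_ideal => u v /dvdpP [a Ea] /dvdpP [b Eb].
  apply/dvd_curve_x; rewrite !(curve_part_conj, curve_partE) Ea Eb.
  move: (ypart u) (ypart v) => c d; rewrite fpq.
  split; apply/dvdpP; first by exists (a * b * p - c * d * q); ring.
  by exists (c * b - a * d); ring.
have /Bezout_eq1_coprimepP [[a b] /= ab] := cpq.
have -> : cx p = cx (a * p) * cx p + (cx (- b) * y) * curve_conj y.
  apply: curve_ext; rewrite !(curve_part_conj, curve_partE); last by ring.
  by rewrite -[LHS]mulr1 -[X in _ * X = _]ab fpq; ring.
rewrite /ramified_ideal; apply: ideal_mulD; apply: mem_ideal_mul.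
- by rewrite !curve_partE dvdp_mull.
- by rewrite !(curve_part_conj, curve_partE) dvdpp.
- by rewrite !curve_partE !(mulr0, mul0r, addr0) dvdp0.
- by rewrite !(curve_part_conj, curve_partE) dvdp0.
Qed.

Lemma ramified_ideal_sqr :
  same_ideal (ideal_mul (ramified_ideal p) (ramified_ideal p))
    (ideal_scale (cx p) unit_ideal).
Proof.
have [_ H] := has_norm_ramified; move=> z; rewrite -H.
by split=> -[s sP ->]; exists s => // uv /sP [? +];
  rewrite /ramified_ideal curve_part_conj.
Qed.

Lemma ramified_invertible : invertible_ideal (ramified_ideal p).
Proof.
have II := ramified_ideal_ideal pf; split=> //.
exists (ramified_ideal p) => //; exists (cx p); first by rewrite curve_x_eq0.
exact: ramified_ideal_sqr.
Qed.

(** The quotient of R by (p, y) is F[x]/p, with the powers of x as a basis. *)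
Lemma ramified_codim : ideal_codim (ramified_ideal p) (size p).-1.
Proof.
exists (fun i => cx 'X^i) => z.
have sumE (c : 'rV[F]_(size p).-1) :
    xpart (z - \sum_(i < (size p).-1) (c 0 i)%:P *: (cx 'X^i : R)) =
    xpart z - rVpoly c.
  rewrite !curve_partE; congr (_ - _).
  rewrite /xpart poly_of_qpoly_sum coef_sum /rVpoly poly_def.
  apply: eq_bigr => i _; rewrite poly_of_qpolyZ coefZ coefC /= mul_polyC.
  by rewrite insubT // => lt; congr (c 0 _ *: _); apply: val_inj.
exists (poly_rV (xpart z %% p)); split.
  rewrite /ramified_ideal sumE poly_rV_K; last first.
    by rewrite -ltnS -polySpred // ltn_modp.
  by rewrite {1}(divp_eq (xpart z) p) addrK dvdp_mull.
move=> c; rewrite /ramified_ideal sumE => pz.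
rewrite -[c]rVpolyK; congr poly_rV.
rewrite -(subrK (rVpoly c) (xpart z)) modpD (eqP pz) add0r modp_small //.
by apply: leq_ltn_trans (size_poly _ _) _; rewrite ltn_predL size_poly_gt0.
Qed.

(** If (p, y) is principal then the norm of a generator is p up to a constant,
    and the generator lies in (p, y); the degrees of the two terms of the norm
    having different parities, p is a constant or f. *)
Lemma ramified_principal a b : a != 0 -> b != 0 ->
  same_ideal (ideal_scale a (ramified_ideal p)) (ideal_scale b unit_ideal) ->
  size p = 1%N \/ size q = 1%N.
Proof.
move=> a0 b0 ab.
have [z pz Eb] : ideal_scale a (ramified_ideal p) b.
  by apply/ab; exists 1; rewrite ?mulr1.
have zP : same_ideal (ideal_scale z unit_ideal) (ramified_ideal p).
  move=> w; split.
    case=> t _ ->; rewrite mulrC.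
    by have [_ _] := ramified_ideal_ideal pf; apply.
  move=> pw; have /ab [t _ Et] : ideal_scale a (ramified_ideal p) (a * w).
    by exists w.
  exists t => //; apply: (curve_mulI fmon fodd a0).
  by rewrite Et Eb mulrA.
have z0 : z != 0 by apply: contraNneq b0 => z0; rewrite Eb z0 mulr0.
have ui : is_ideal unit_ideal by [].
have := has_norm_scale fmon fodd z0 ui (has_norm_unit f).
rewrite mulr1 => /(has_norm_same zP) nz.
have Np := has_norm_uniq nz has_norm_ramified.
have [_ q0] := monic_factor_neq0 fmon fpq.
have sf : size f = ((size p).-1 + (size q).-1).+1.
  by rewrite fpq size_mul // (polySpred p0) (polySpred q0) addnS.
have := curve_norm_lead fmon fodd z0; rewrite (eqp_size Np) => -[+ _].
have sp0 : (0 < size p)%N by rewrite size_poly_gt0.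
have sq0 : (0 < size q)%N by rewrite size_poly_gt0.
rewrite /pole_order -/(xpart z) -/(ypart z).
have [y0|y0] /= := eqVneq (ypart z) 0; last first.
  move=> sp; right; have : ((size f).-1 < size p)%N.
    by rewrite sp ltnS leq_max leq_addl orbT.
  rewrite sf /=; move: sp0 sq0; clear.
  by move: (size p) (size q) => s t; lia.
move=> sp; left; have x0 : xpart z != 0.
  by apply: contraNneq z0 => x0; apply/eqP/curve_ext; rewrite !curve_partE.
have := dvdp_leq x0 pz; have : (0 < size (xpart z))%N by rewrite size_poly_gt0.
move: sp0 sp; clear; move: (size p) (size (xpart z)) => s t; lia.
Qed.
End Split.
End RamifiedIdeals.

(** * Square roots of 1 and ideals with principal square *)

Section TwoTorsion.
Variables (F : fieldType) (f : {poly F}).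
Hypotheses (fmon : f \is monic) (fodd : odd (size f).-1).
Hypothesis two_neq0 : (2%:R : F) != 0.

Notation A := {poly F}.
Notation R := {poly %/ ('X^2 - f%:P)}.
Notation cx := (@curve_x F f).
Notation y := (@curve_y F f).
Notation unit_ideal := (@unit_ideal F f).
Notation ramified_ideal := (@ramified_ideal F f).
Implicit Types (I J K M : R -> Prop) (e h p q : A).

Lemma coprimep_add1_sub1 e : coprimep (e + 1) (e - 1).
Proof.
apply/Bezout_eq1_coprimepP; exists ((2%:R^-1)%:P, - (2%:R^-1)%:P) => /=.
have -> : (2%:R^-1)%:P * (e + 1) + - (2%:R^-1)%:P * (e - 1) =
  (2%:R^-1)%:P * (2%:R)%:P by rewrite polyC_natr; ring.
by rewrite -polyCM mulVf.
Qed.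

Definition root_split e p q :=
  [/\ f = p * q, coprimep p q, p %| e + 1 & q %| e - 1].

Lemma root_split_exists e : f %| e ^+ 2 - 1 -> exists p q, root_split e p q.
Proof.
move=> fe; pose p := gcdp f (e + 1).
have f0 := monic_neq0 fmon.
have pf : p %| f by apply: dvdp_gcdl.
have pe : p %| e + 1 by apply: dvdp_gcdr.
have p0 : p != 0 by rewrite gcdp_eq0 (negPf f0).
have qe : f %/ p %| e - 1.
  have E : f %/ p * p = f by rewrite divpK.
  have E' : (e + 1) %/ p * p = e + 1 by rewrite divpK.
  rewrite -(@Gauss_dvdpr _ _ ((e + 1) %/ p)).
    rewrite -(@dvdp_mul2r _ p) // E mulrAC E'.
    by rewrite (_ : _ * _ = e ^+ 2 - 1) //; ring.
  by apply: coprimep_div_gcd; rewrite f0.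
exists p, (f %/ p); split=> //; first by rewrite mulrC divpK.
exact: coprimep_dvdr pe (coprimep_dvdl qe (coprimep_add1_sub1 e)).
Qed.

(** This identifies the ideal (e + 1, y) with (p, y): the factor q of f is prime
    to e + 1, as it divides e - 1. *)
Lemma root_split_gcd e p q x : root_split e p q -> (gcdp (e + 1) f %| x) = (p %| x).
Proof.
case=> fpq cpq pe qe; apply: eqp_dvdl; rewrite /eqp dvdp_gcd pe fpq dvdp_mulr // andbT.
rewrite -(@Gauss_dvdpl _ _ q) ?dvdp_gcdr //.
apply: coprimep_dvdr (dvdp_gcdl _ _) _.
exact: coprimep_dvdl qe (coprimep_add1_sub1 e).
Qed.

Lemma root_split_sqr e p q : root_split e p q -> f %| e ^+ 2 - 1.
Proof.
case=> -> _ pe qe; rewrite (_ : e ^+ 2 - 1 = (e + 1) * (e - 1)); last by ring.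
exact: dvdp_mul.
Qed.

(** Where exactly one of the two roots is -1, the product is -1: with
    p = p1 a and p' = p1 b for the greatest common divisor p1, these are the
    roots of a b, and the product of (p, y) and (p', y) is p1 (a b, y). *)
Lemma root_split_mul e e' p q p' q' : root_split e p q -> root_split e' p' q' ->
  exists p1 p'' q'', [/\ root_split (e * e') p'' q'', p * p' = p1 ^+ 2 * p'' &
    same_ideal (ideal_mul (ramified_ideal p) (ramified_ideal p'))
      (ideal_scale (cx p1) (ramified_ideal p''))].
Proof.
move=> [fpq cpq pe qe] [fpq' cpq' pe' qe'].
have [p0 _] := monic_factor_neq0 fmon fpq.
have [p0' _] := monic_factor_neq0 fmon fpq'.
pose p1 := gcdp p p'.
have p10 : p1 != 0 by rewrite gcdp_eq0 (negPf p0).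
pose a := p %/ p1; pose b := p' %/ p1.
have Ep : p = p1 * a by rewrite mulrC divpK ?dvdp_gcdl.
have Ep' : p' = p1 * b by rewrite mulrC divpK ?dvdp_gcdr.
have cab : coprimep a b by apply: coprimep_div_gcd; rewrite p0.
have a0 : a != 0 by apply: contraNneq p0 => a0; rewrite Ep a0 mulr0.
have b0 : b != 0 by apply: contraNneq p0' => b0; rewrite Ep' b0 mulr0.
have aqbq : a * q = b * q'.
  by apply: (mulfI p10); rewrite !mulrA -Ep -Ep' -fpq -fpq'.
have /dvdpP [c Eq] : b %| q.
  by rewrite -(@Gauss_dvdpr _ _ a) 1?coprimep_sym // aqbq dvdp_mulr.
have Eq' : q' = a * c.
  by apply: (mulfI b0); rewrite -aqbq Eq; ring.
have ap : a %| p by rewrite Ep dvdp_mull.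
have bp' : b %| p' by rewrite Ep' dvdp_mull.
have bq : b %| q by rewrite Eq dvdp_mull.
have aq' : a %| q' by rewrite Eq' dvdp_mulr.
have cq : c %| q by rewrite Eq dvdp_mulr.
have cq' : c %| q' by rewrite Eq' dvdp_mull.
have p1p : p1 %| p by apply: dvdp_gcdl.
have p1p' : p1 %| p' by apply: dvdp_gcdr.
have cp1c : coprimep p1 c by apply: coprimep_dvdr p1p (coprimep_dvdl cq cpq).
have fE : f = a * b * (p1 * c) by rewrite fpq Ep Eq; ring.
have ppE : p * p' = p1 ^+ 2 * (a * b) by rewrite Ep Ep'; ring.
exists p1, (a * b), (p1 * c); split=> //.
  split=> //.
  - rewrite coprimepMl !coprimepMr.
    rewrite (coprimep_dvdr ap (coprimep_dvdl cq cpq)).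
    rewrite (coprimep_dvdr bp' (coprimep_dvdl cq' cpq')).
    rewrite [coprimep a p1]coprimep_sym (coprimep_dvdr p1p' (coprimep_dvdl aq' cpq')).
    by rewrite [coprimep b p1]coprimep_sym (coprimep_dvdr p1p (coprimep_dvdl bq cpq)).
  - rewrite Gauss_dvdp //; apply/andP; split.
      rewrite (_ : _ + 1 = e' * (e + 1) - (e' - 1)); last by ring.
      apply: dvdp_sub; last exact: dvdp_trans aq' qe'.
      by apply: dvdp_mull; apply: dvdp_trans ap pe.
    rewrite (_ : _ + 1 = e * (e' + 1) - (e - 1)); last by ring.
    apply: dvdp_sub; last exact: dvdp_trans bq qe.
    by apply: dvdp_mull; apply: dvdp_trans bp' pe'.
  - rewrite Gauss_dvdp //; apply/andP; split.
      rewrite (_ : _ - 1 = e' * (e + 1) - (e' + 1)); last by ring.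
      apply: dvdp_sub; last exact: dvdp_trans p1p' pe'.
      by apply: dvdp_mull; apply: dvdp_trans p1p pe.
    rewrite (_ : _ - 1 = e' * (e - 1) + (e' - 1)); last by ring.
    apply: dvdp_add; last exact: dvdp_trans cq' qe'.
    by apply: dvdp_mull; apply: dvdp_trans cq qe.
move=> z; split.
  elim/ideal_mul_ind: z / => [|u v [w wP ->] [w' wP' ->]|u v].
  - by exists 0; rewrite ?mulr0 /ramified_ideal ?curve_partE ?dvdp0.
  - exists (w + w'); last by rewrite mulrDr.
    by rewrite /ramified_ideal curve_partE; apply: dvdp_add.
  rewrite /ramified_ideal => /dvdpP [s Es] /dvdpP [t Et].
  exists (cx (s * t * p1 * a * b + ypart u * ypart v * (a * b * c)) +
          cx (s * a * ypart v + ypart u * t * b) * y).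
    rewrite !curve_partE !(mul0r, mulr0, addr0, mulr1).
    by apply: dvdp_add; [rewrite -mulrA dvdp_mull | apply: dvdp_mull; apply: dvdp_mulr].
  apply: curve_ext; rewrite !curve_partE ?Es ?Et; move: (ypart u) (ypart v) => u1 v1.
    by rewrite fE Ep Ep'; ring.
  by rewrite Ep Ep'; ring.
case=> w /dvdpP [s Es] ->.
have pf : p %| f by rewrite fpq dvdp_mulr.
have [_ D M] := is_ideal_mul (ramified_ideal p') (ramified_ideal_ideal pf).
have K u v : p %| xpart u -> p' %| xpart v -> forall r,
    ideal_mul (ramified_ideal p) (ramified_ideal p') (r * (u * v)).
  by move=> pu pv r; apply: M; apply: mem_ideal_mul.
have /Bezout_eq1_coprimepP [[al be] /= ab] := cab.
have /Bezout_eq1_coprimepP [[ga de] /= gd] := cp1c.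
have E : cx p1 * w =
   (cx (s * ga) * (cx p * cx p') + cx (s * de) * (y * y)) +
   (cx (ypart w * al) * (cx p * y) + cx (ypart w * be) * (y * cx p')).
  apply: curve_ext; rewrite !curve_partE ?Es; move: (ypart w) => w1.
    transitivity (p1 * (s * (a * b)) * (ga * p1 + de * c)).
      by rewrite gd; ring.
    by rewrite fE Ep Ep'; ring.
  transitivity (p1 * w1 * (al * a + be * b)); first by rewrite ab; ring.
  by rewrite Ep Ep'; ring.
rewrite E; apply: (D); apply: (D); apply: K; rewrite ?curve_partE ?dvdp0 ?dvdpp //.
Qed.

(** From a I^2 = b R and I conj(I) = h R, the ideal I is w conj(I) with
    w = b / (a h). The norm of w is a constant, and it is a square l^2: by
    [curve_norm_lead] the leading coefficients of norms of even degree, and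
    those of odd degree, differ by squares. Now w / l = u / conj u for
    u = 1 + w / l, so that conj(u) I is stable under conjugation; if u = 0 then
    I itself is stable. Being stable, the multiple of I is k (p, y) with
    f = p q. It has a norm rho, and its square is rho R. As k^2 p y is in the
    square, rho divides k^2 p, which is thus in the square too; but elements of
    the square have their first coordinate divisible by k^2 p gcd(p, q). *)
Lemma two_torsion_ideal I h (a b : R) : is_ideal I -> has_norm I h ->
  a != 0 -> b != 0 ->
  same_ideal (ideal_scale a (ideal_mul I I)) (ideal_scale b unit_ideal) ->
  exists (U : R) (k p q : A), [/\ U != 0, k != 0, f = p * q, coprimep p q &
    same_ideal (ideal_scale U I) (ideal_scale (cx k) (ramified_ideal p))].
Proof.
move=> II nI a0 b0 ab; have [I0 ID IM] := II; have [h0 _] := nI.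
have III : is_ideal (ideal_mul I I) by apply: is_ideal_mul.
have Nab : curve_norm a * (h * h) %= curve_norm b.
  apply: has_norm_uniq (has_norm_scale fmon fodd a0 III (has_norm_mul II nI nI)) _.
  apply: has_norm_same => [z|]; first by symmetry; apply: ab.
  rewrite -[curve_norm b]mulr1.
  by apply: has_norm_scale => //; apply: has_norm_unit.
have Na0 := curve_norm_neq0 fmon fodd a0.
have Nb0 := curve_norm_neq0 fmon fodd b0.
have [l l0 El] : exists2 l : F, l != 0 &
    curve_norm b = l%:P ^+ 2 * (curve_norm a * h ^+ 2).
  have [sa [u u0 Eu]] := curve_norm_lead fmon fodd a0.
  have [sb [v v0 Ev]] := curve_norm_lead fmon fodd b0.
  have par : odd (pole_order a) = odd (pole_order b).
    have := eqp_size Nab; rewrite size_mul ?mulf_neq0 // sa sb -expr2.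
    by rewrite size_sqr // addnS => -[<-]; rewrite addnC oddD odd_double.
  have hl0 : lead_coef h != 0 by rewrite lead_coef_eq0.
  exists (v / (u * lead_coef h)); first by rewrite mulf_neq0 ?invr_neq0 ?mulf_neq0.
  have sgE : (- 1) ^+ pole_order a = (- 1) ^+ pole_order b :> F.
    by rewrite -signr_odd par signr_odd.
  have := eqp_eq Nab; rewrite !lead_coefM Eu Ev sgE.
  set sg := (- 1) ^+ _ => E.
  have sg0 : sg != 0 by rewrite expf_neq0 // oppr_eq0 oner_eq0.
  have cc : sg * u ^+ 2 * (lead_coef h * lead_coef h) != 0.
    by apply: mulf_neq0; apply: mulf_neq0 => //; apply: expf_neq0.
  apply: (scalerI cc); rewrite -E -polyC_exp mul_polyC scalerA -[h * h]expr2.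
  by congr (_ *: _); field; rewrite hl0.
pose L := cx l%:P; pose H := cx h; pose Na := cx (curve_norm a).
have L0 : L != 0 by rewrite curve_x_eq0 polyC_eq0.
have H0 : H != 0 by rewrite curve_x_eq0.
have NaE : a * curve_conj a = Na by rewrite mul_conj.
have NbE : b * curve_conj b = L * L * (Na * (H * H)).
  by rewrite mul_conj -!curve_xM; congr (cx _); rewrite El; ring.
(* conj(I) = (a h / b) I, cleared of denominators *)
have Eq1 t : I t -> exists2 t', I t' & b * curve_conj t = a * (H * t').
  move=> It; have : ideal_scale a (ideal_mul I I) b.
    by apply/ab; exists 1; rewrite ?mulr1.
  case=> z zP ->.
  have [t' It' Et'] : exists2 t', I t' & z * curve_conj t = H * t'.
    elim/ideal_mul_ind: z / zP => [|z z' [s Is Es] [s' Is' Es']|u v Iu Iv].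
    - by exists 0; rewrite // mul0r mulr0.
    - by exists (s + s'); [apply: ID | rewrite mulrDl Es Es' mulrDr].
    have [w Ew] := has_norm_dvd nI Iv It.
    by exists (u * w); [rewrite mulrC; apply: IM | rewrite -mulrA Ew mulrCA].
  by exists t' => //; rewrite -mulrA Et'.
(* a multiple of conj u *)
pose U := L * Na * H + a * curve_conj b.
have cL : curve_conj L = L by apply: curve_conj_x.
have cNa : curve_conj Na = Na by apply: curve_conj_x.
have cH : curve_conj H = H by apply: curve_conj_x.
have conjU t : I t -> exists2 t', I t' & L * curve_conj (U * t) = U * t' /\
    curve_conj (U * t) = Na * H * (L * curve_conj t + t').
  move=> It; have [t' It' Et'] := Eq1 t It; exists t' => //.
  have Eq2 : L * L * Na * H * curve_conj t = a * curve_conj b * t'.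
    apply: (curve_mulI fmon fodd H0); rewrite (_ : H * (a * _ * _) =
      curve_conj b * (a * (H * t'))); last by ring.
    rewrite -Et' (_ : curve_conj b * _ = (b * curve_conj b) * curve_conj t).
      by rewrite NbE; ring.
    by ring.
  have E : curve_conj (U * t) = Na * H * (L * curve_conj t + t').
    rewrite curve_conjM /U curve_conjD !curve_conjM curve_conjK cL cNa cH mulrDl.
    rewrite -[_ * b * _]mulrA Et' (_ : _ * (a * _) = (a * curve_conj a) * (H * t')).
      by rewrite NaE; ring.
    by ring.
  split=> //; rewrite E /U [RHS]mulrDl -Eq2; ring.
pose Li := cx (l^-1)%:P.
have LiL : Li * L = 1.
  by rewrite -curve_xM -polyCM mulVf.
have [V V0 Vconj] : exists2 V, V != 0 &
    forall t, I t -> exists2 t', I t' & curve_conj (V * t) = V * t'.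
  have [U0|U0] := eqVneq U 0; last first.
    exists U => // t /conjU [t' It' [E _]]; exists (Li * t'); first exact: IM.
    by rewrite mulrCA -E mulrA LiL mul1r.
  exists 1; first exact: oner_neq0.
  move=> t /conjU [t' It' [_]]; rewrite U0 mul0r curve_conj0 => E.
  exists (- Li * t'); first exact: IM.
  have {}E : L * curve_conj t + t' = 0.
    have NH0 : Na * H != 0 by apply: curve_mul_neq0 => //; rewrite curve_x_eq0.
    by apply: (curve_mulI fmon fodd NH0); rewrite -E mulr0.
  rewrite !mul1r -[LHS]mul1r -LiL -mulrA (_ : L * _ = - t'); first by ring.
  by apply/eqP; rewrite -addr_eq0 E.
pose M := ideal_scale V I.
have MI : is_ideal M by apply: is_ideal_scale.
have Mconj z : M z -> M (curve_conj z).
  by case=> t It ->; have [t' It' ->] := Vconj t It; exists t'.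
have [u0 Iu0 u0_neq0] := has_norm_neq0 nI.
have Mu0 : M (V * u0) by exists u0.
have [k [p [k0 pf MP]]] := conj_stable_ideal two_neq0 MI Mconj Mu0
  (curve_mul_neq0 fmon fodd V0 u0_neq0).
have /dvdpP [q Eq] := pf.
have nM := has_norm_scale fmon fodd V0 II nI; rewrite -/M in nM.
set rho := curve_norm V * h in nM.
have rk : rho %| k ^+ 2 * p.
  have : exists w, cx (k * p) * curve_conj (cx k * y) = cx rho * w.
    apply: (has_norm_dvd nM); apply/MP; rewrite !curve_partE.
      by rewrite dvdpp dvdp0.
    by rewrite !(mul0r, mulr0, addr0, mulr1) dvdp0 dvdpp.
  case/dvd_curve_x=> _.
  rewrite !(curve_part_conj, curve_partE) !(mul0r, mulr0, addr0, mulr1).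
  by rewrite mulrN dvdpNr mulrAC -expr2.
have [_ p0] := monic_factor_neq0 fmon Eq.
have cpq : coprimep p q.
  have [w Ew] := dvdpP _ _ rk.
  have : k ^+ 2 * p * gcdp p q %| xpart (cx rho * cx w).
    apply: (has_norm_ind (K := fun z => k ^+ 2 * p * gcdp p q %| xpart z) nM).
    - by rewrite curve_partE dvdp0.
    - by move=> u v Ku Kv; rewrite curve_partE dvdp_add.
    move=> u v /MP [/dvdpP [u1 Eu1] /dvdpP [u2 Eu2]].
    move=> /MP [/dvdpP [v1 Ev1] /dvdpP [v2 Ev2]].
    rewrite !(curve_part_conj, curve_partE) Eu1 Eu2 Ev1 Ev2.
    rewrite [X in _ %| _ + _ * X]Eq.
    rewrite (_ : _ + _ = k ^+ 2 * p * (u1 * v1 * p - u2 * v2 * q)); last by ring.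
    rewrite dvdp_mul2l ?mulf_neq0 ?expf_neq0 //.
    by rewrite dvdp_sub // dvdp_mull // (dvdp_gcdl, dvdp_gcdr).
  rewrite -curve_xM curve_partE [rho * w]mulrC -Ew -[X in _ %| X]mulr1.
  by rewrite dvdp_mul2l ?mulf_neq0 ?expf_neq0 // dvdp1 -coprimep_def.
exists V, k, p, q; split=> //; first by rewrite mulrC.
move=> z; rewrite -/(M z) MP; split.
  move=> [/dvdpP [x Ex] /dvdpP [x' Ex']].
  exists (cx (x * p) + cx x' * y).
    rewrite /ramified_ideal !curve_partE !(mul0r, mulr0, addr0, mulr1).
    by rewrite dvdp_mull.
  by apply: curve_ext; rewrite !curve_partE ?Ex ?Ex'; ring.
case=> w; rewrite /ramified_ideal => pw ->.
by rewrite !curve_partE !mul0r !addr0 dvdp_mul2l // dvdp_mulr.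
Qed.
End TwoTorsion.

(** * Square roots of 1 and the 2-torsion of the Jacobian *)

Section QuotientPoly.
Variables (F : fieldType) (f : {poly F}).
Hypotheses (fmon : f \is monic) (fsize : (1 < size f)%N).

Lemma mk_monic_id : mk_monic f = f.
Proof. by rewrite /mk_monic fsize fmon. Qed.

Lemma in_qpolyK (e : {poly %/ f}) : in_qpoly f e = e.
Proof. by apply/val_inj/in_qpoly_small/size_mk_monic. Qed.

Lemma in_qpoly_eqP (p q : {poly F}) :
  in_qpoly f p = in_qpoly f q <-> f %| p - q.
Proof.
have E r : val (in_qpoly f r) = r %% f.
  by rewrite /= mk_monic_id Pdiv.IdomainMonic.modpE.
split=> [/(congr1 val)|fpq].
  by rewrite !E /dvdp modpD modpN => ->; rewrite subrr.
by apply: val_inj; rewrite !E -{1}(subrK q p) modpD (eqP fpq) add0r.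
Qed.

Lemma qpoly_sqr1P (e : {poly %/ f}) : e ^+ 2 = 1 <-> f %| (e : {poly F}) ^+ 2 - 1.
Proof. by rewrite -in_qpoly_eqP rmorphXn /= in_qpolyK rmorph1. Qed.
End QuotientPoly.

Section JacobianTwoTorsion.
Variables (F : fieldType) (f : {poly F}).
Hypotheses (fmon : f \is monic) (fodd : odd (size f).-1).
Hypothesis two_neq0 : (2%:R : F) != 0.

Notation A := {poly F}.
Notation R := {poly %/ ('X^2 - f%:P)}.
Notation cx := (@curve_x F f).
Notation y := (@curve_y F f).
Notation unit_ideal := (@unit_ideal F f).
Notation ramified_ideal := (@ramified_ideal F f).
Notation divisor := (divisor f).
Notation root_split := (root_split f).
Implicit Types (I J K M : R -> Prop) (D E : divisor) (e : {poly %/ f}).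

Let fsize : (1 < size f)%N.
Proof. by case: (size f) fodd => [|[]]. Qed.

(** Turned into an equality, this lets ideals be rewritten. *)
Lemma same_ideal_eq I J : same_ideal I J -> I = J.
Proof.
move=> IJ; apply: functional_extensionality => z.
exact: propositional_extensionality.
Qed.

Lemma lin_equiv_sym D E : lin_equiv D E -> lin_equiv E D.
Proof. by case=> a [b [a0 b0 I m]]; exists b, a; split=> // z; rewrite (I z). Qed.

Lemma ideal_scaleA (a b : R) I :
  ideal_scale a (ideal_scale b I) = ideal_scale (a * b) I.
Proof.
apply: same_ideal_eq => z; split=> [[_ [u Iu ->] ->]|[u Iu ->]].
  by exists u; rewrite ?mulrA.
by exists (b * u); [exists u | rewrite mulrA].
Qed.

Lemma ideal_scale_mull (a : R) I J :
  ideal_mul (ideal_scale a I) J = ideal_scale a (ideal_mul I J).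
Proof.
apply: same_ideal_eq => z; split.
  elim/ideal_mul_ind: z / => [|u v [u' Iu ->] [v' Iv ->]|u v [u' Iu ->] Jv].
  - by exists 0; rewrite ?mulr0 //; apply: ideal_mul0.
  - by exists (u' + v'); rewrite ?mulrDr //; apply: ideal_mulD.
  - by exists (u' * v); rewrite ?mulrA //; apply: mem_ideal_mul.
case=> w + ->; elim/ideal_mul_ind: w / => [|u v Hu Hv|u v Iu Jv].
- by rewrite mulr0; apply: ideal_mul0.
- by rewrite mulrDr; apply: ideal_mulD.
- by rewrite mulrA; apply: mem_ideal_mul => //; exists u.
Qed.

Lemma ideal_mulC I J : ideal_mul I J = ideal_mul J I.
Proof.
apply: same_ideal_eq => z.
have H I' J' : ideal_mul I' J' z -> ideal_mul J' I' z.
  elim/ideal_mul_ind: z / => [|u v Hu Hv|u v Iu Jv].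
  - exact: ideal_mul0.
  - exact: ideal_mulD.
  - by rewrite mulrC; apply: mem_ideal_mul.
by split; apply: H.
Qed.

Lemma lin_equiv_trans D E G : lin_equiv D E -> lin_equiv E G -> lin_equiv D G.
Proof.
case=> a [b [a0 b0 /same_ideal_eq I m]] [c [d [c0 d0 /same_ideal_eq J m']]].
exists (a * c), (b * d); split; rewrite ?curve_mul_neq0 //.
  rewrite [a * c]mulrC -(ideal_scaleA c a) I ideal_scaleA.
  by rewrite [c * b]mulrC -(ideal_scaleA b c) J ideal_scaleA.
rewrite !pole_orderM // !PoszD; move: m m'; clear.
move: D.2 E.2 G.2 => x z t; move: (pole_order a) (pole_order b) (pole_order c) => u v w.
by lia.
Qed.

Lemma lin_equiv_add D D' E E' :
  lin_equiv D E -> lin_equiv D' E' -> lin_equiv (div_add D D') (div_add E E').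
Proof.
case=> a [b [a0 b0 /same_ideal_eq I m]] [c [d [c0 d0 /same_ideal_eq J m']]].
exists (a * c), (b * d); split; rewrite ?curve_mul_neq0 //.
  have K (u v : R) (I1 I2 : R -> Prop) : ideal_scale (u * v) (ideal_mul I1 I2) =
      ideal_mul (ideal_scale u I1) (ideal_scale v I2).
    rewrite ideal_scale_mull [ideal_mul I1 (ideal_scale _ _)]ideal_mulC.
    by rewrite ideal_scale_mull ideal_scaleA ideal_mulC.
  by rewrite /= !K I J.
by rewrite /= !pole_orderM // !PoszD !opprD addrACA m m' addrACA.
Qed.

Lemma degree_balance (a b c d : nat) :
  (a + c = b + d)%N -> - c%:Z - a%:Z = - d%:Z - b%:Z.
Proof. by lia. Qed.

(** Linearly equivalent divisors have the same degree: degrees of ideals are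
    degrees of norms, and norms are multiplicative. *)
Lemma degree_scale_eq I J h h' (a b : R) : is_ideal I -> is_ideal J ->
  has_norm I h -> has_norm J h' -> a != 0 -> b != 0 ->
  same_ideal (ideal_scale a I) (ideal_scale b J) ->
  (pole_order a + (size h).-1 = pole_order b + (size h').-1)%N.
Proof.
move=> II JJ nI nJ a0 b0 IJ.
have [h0 _] := nI; have [h0' _] := nJ.
have := has_norm_uniq (has_norm_same IJ (has_norm_scale fmon fodd a0 II nI))
  (has_norm_scale fmon fodd b0 JJ nJ).
move/eqp_size; rewrite !size_mul ?curve_norm_neq0 //.
have [-> _] := curve_norm_lead fmon fodd a0.
have [-> _] := curve_norm_lead fmon fodd b0.
rewrite /= -size_poly_gt0 in h0; rewrite -size_poly_gt0 in h0'.
by move: h0 h0'; move: (size h) (size h') => [|s] [|t]; lia.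
Qed.

(** Twice the degree of D is the degree of a principal divisor, that is 0. *)
Lemma in_J2_degree D h : in_J2 D -> has_norm D.1 h -> D.2 = - (size h).-1%:Z.
Proof.
case=> [[[II _] _] [a [b [a0 b0 /= IJ /= m]]]] nI.
have ui : is_ideal unit_ideal by [].
have := degree_scale_eq (is_ideal_mul _ II) ui (has_norm_mul II nI nI)
  (has_norm_unit f) a0 b0 IJ.
rewrite size_poly1; move: nI => [h0 _].
rewrite -[h * h]expr2 size_sqr // -addnn.
move: m; move: (pole_order a) (pole_order b) D.2 (size h).-1 => u v x w; clear.
by lia.
Qed.

Definition ramified_div (p : A) : divisor := (ramified_ideal p, - (size p).-1%:Z).

Lemma root_split_gen e p q : root_split e p q ->
  ideal_gen2 (cx (e : {poly F}) + 1) y = ramified_ideal p.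
Proof.
move=> sp; apply: same_ideal_eq => z; rewrite -curve_x1 -curve_xD ideal_gen2_gcd.
by rewrite /ramified_ideal (root_split_gcd two_neq0 _ sp).
Qed.

Lemma qpoly_root_split e : e ^+ 2 = 1 -> exists p q, root_split e p q.
Proof. by move/(qpoly_sqr1P fmon fsize); apply: root_split_exists. Qed.

Lemma ramified_div_deg0 e p q : root_split e p q -> div_deg0 (ramified_div p).
Proof.
case=> fpq cpq _ _; split; first exact: (ramified_invertible fmon fpq).
by exists (size p).-1; [apply: (ramified_codim fmon fpq) | rewrite /= subrr].
Qed.

Lemma J2_correspI D e p q : root_split e p q -> lin_equiv D (ramified_div p) ->
  J2_corresp D e.
Proof.
move=> sp Dp; split; first exact/(qpoly_sqr1P fmon fsize)/(root_split_sqr sp).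
exists (- (size p).-1%:Z); rewrite (root_split_gen sp); split=> //.
exact: (ramified_div_deg0 sp).
Qed.

(** The multiplicity at infinity in the definition of the correspondence is
    forced, since D has degree 0. *)
Lemma J2_correspE D e p q : in_J2 D -> root_split e p q -> J2_corresp D e ->
  lin_equiv D (ramified_div p).
Proof.
move=> JD sp [_ [m]]; rewrite (root_split_gen sp) => /= -[_ H].
have [fpq cpq _ _] := sp.
suff -> : ramified_div p = (ramified_ideal p, m) by [].
have [[inv _] _] := JD; have [II _] := inv.
have [h nI] := invertible_has_norm fmon fodd two_neq0 inv.
have D2 := in_J2_degree JD nI.
case: H => a [b [a0 b0 /= IJ /= E]].
have pI : is_ideal (ramified_ideal p).
  by apply: ramified_ideal_ideal; rewrite fpq dvdp_mulr.
have := degree_scale_eq II pI nI (has_norm_ramified fmon fpq cpq) a0 b0 IJ.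
move=> /degree_balance E'; congr (_, _).
by apply: (addIr (- (pole_order b)%:Z)); rewrite -E D2 E'.
Qed.

Lemma ramified_div_J2 e p q : root_split e p q -> in_J2 (ramified_div p).
Proof.
move=> sp; split; first exact: ramified_div_deg0 sp.
have [fpq cpq _ _] := sp.
have [p0 _] := monic_factor_neq0 fmon fpq.
exists 1, (cx p); split; [exact: oner_neq0 | by rewrite curve_x_eq0 | |].
  move=> z; rewrite -(ramified_ideal_sqr fmon fpq cpq z).
  by split=> [[w Iw ->]|Iz]; [rewrite mul1r | exists z; rewrite ?mul1r].
rewrite pole_order_x // -[1]/(cx 1) pole_order_x ?oner_neq0 // size_poly1 /=.
by rewrite subr0 sub0r -addnn PoszD opprD.
Qed.

Lemma J2_corresp0 : J2_corresp (div_zero f) 1.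
Proof.
have sp : root_split (1 : {poly %/ f}) 1 f.
  split; rewrite ?mul1r ?coprime1p ?dvd1p //.
  by rewrite (_ : _ - 1 = 0) ?dvdp0 //= subrr.
apply: (J2_correspI sp); exists 1, 1; split; rewrite ?oner_neq0 //.
  move=> z; split=> -[w _ ->]; exists w => //; exact: dvd1p.
by rewrite /= size_poly1.
Qed.

(** The ideal of D is a multiple of (p, y) with p and q = f / p coprime; the
    Chinese remainder theorem gives the root that is -1 modulo p and 1 modulo q. *)
Lemma J2_corresp_exists D : in_J2 D -> exists e, J2_corresp D e.
Proof.
move=> JD; have [[inv _] H] := JD; have [II _] := inv.
have [h nI] := invertible_has_norm fmon fodd two_neq0 inv.
case: H => a [b [a0 b0 /= ab _]].
have [U [k [p [q [U0 k0 fpq cpq UI]]]]] :=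
  two_torsion_ideal fmon fodd two_neq0 II nI a0 b0 ab.
have /Bezout_eq1_coprimepP [[al be] /= E] := cpq.
pose e := in_qpoly f (al * p - be * q).
have fe : f %| (e : {poly F}) - (al * p - be * q).
  by apply/(in_qpoly_eqP fmon fsize); rewrite in_qpolyK.
have sp : root_split e p q.
  split=> //.
    rewrite (_ : _ + 1 = ((e : {poly F}) - (al * p - be * q)) + (al + al) * p).
      by rewrite dvdp_add ?dvdp_mull //; apply: dvdp_trans fe; rewrite fpq dvdp_mulr.
    by rewrite -E; ring.
  rewrite (_ : _ - 1 = ((e : {poly F}) - (al * p - be * q)) - (be + be) * q).
    by rewrite dvdp_sub ?dvdp_mull //; apply: dvdp_trans fe; rewrite fpq dvdp_mull.
  by rewrite -E; ring.
exists e; apply: (J2_correspI sp).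
exists U, (cx k); split; rewrite ?curve_x_eq0 //=.
rewrite (in_J2_degree JD nI).
have pI : is_ideal (ramified_ideal p).
  by apply: ramified_ideal_ideal; rewrite fpq dvdp_mulr.
have kx0 : cx k != 0 by rewrite curve_x_eq0.
apply: degree_balance.
exact: degree_scale_eq II pI nI (has_norm_ramified fmon fpq cpq) U0 kx0 UI.
Qed.

Lemma J2_corresp_of e : e ^+ 2 = 1 -> exists2 D, in_J2 D & J2_corresp D e.
Proof.
case/qpoly_root_split=> p [q sp]; exists (ramified_div p).
  exact: ramified_div_J2 sp.
apply: (J2_correspI sp); exists 1, 1; split=> //; exact: oner_neq0.
Qed.

(** Reducing a product of roots modulo f does not affect its signs. *)
Lemma qpoly_mul_split e e' p q : root_split ((e : {poly F}) * e') p q ->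
  root_split ((e * e' : {poly %/ f}) : {poly F}) p q.
Proof.
case=> fpq cpq pe qe.
have fe : f %| ((e * e' : {poly %/ f}) : {poly F}) - (e : {poly F}) * e'.
  by apply/(in_qpoly_eqP fmon fsize); rewrite in_qpolyK in_qpolyM !in_qpolyK.
split=> //.
  rewrite -(subrK ((e : {poly F}) * e') ((e * e' : {poly %/ f}) : {poly F})) -addrA.
  by rewrite dvdp_add //; apply: dvdp_trans fe; rewrite fpq dvdp_mulr.
rewrite -(subrK ((e : {poly F}) * e') ((e * e' : {poly %/ f}) : {poly F})) -addrA.
by rewrite dvdp_add //; apply: dvdp_trans fe; rewrite fpq dvdp_mull.
Qed.

Lemma J2_correspM D D' e e' : in_J2 D -> in_J2 D' ->
  J2_corresp D e -> J2_corresp D' e' -> J2_corresp (div_add D D') (e * e').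
Proof.
move=> JD JD' cD cD'.
have [p [q sp]] := qpoly_root_split (proj1 cD).
have [p' [q' sp']] := qpoly_root_split (proj1 cD').
have [p1 [p2 [q2 [sp2 ppE IJ]]]] := root_split_mul fmon sp sp'.
apply: (J2_correspI (qpoly_mul_split sp2)).
apply: lin_equiv_trans
  (lin_equiv_add (J2_correspE JD sp cD) (J2_correspE JD' sp' cD')) _.
have neq0 s t (u : A) : root_split u s t -> s != 0.
  by case=> /(monic_factor_neq0 fmon) [].
have p0 := neq0 _ _ _ sp; have p0' := neq0 _ _ _ sp'; have p20 := neq0 _ _ _ sp2.
have p10 : p1 != 0.
  by apply: contraTneq (mulf_neq0 p0 p0') => p10; rewrite ppE p10 expr0n mul0r eqxx.
exists 1, (cx p1); split; [exact: oner_neq0 | by rewrite curve_x_eq0 | |].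
  move=> z; rewrite -(IJ z).
  by split=> [[w Iw ->]|Iz]; [rewrite mul1r | exists z; rewrite ?mul1r].
rewrite pole_order_x // -[1]/(cx 1) pole_order_x ?oner_neq0 // size_poly1 /=.
have /= := congr1 (fun p : A => size p) ppE.
rewrite size_mul // [RHS]size_mul ?expf_neq0 // size_sqr //.
rewrite /= -addnn; move: p0 p0' p20; rewrite -!size_poly_gt0.
move: (size p) (size p') (size p2) (size p1); clear.
by move=> [|s] [|s'] [|s2] [|s1] //=; lia.
Qed.

(** If (p, y) and (p', y) are in the same class then the ideal of e e' is
    principal, as the square of (p', y) is; so e e' is 1 or -1. *)
Lemma J2_corresp_inj D D' e e' : J2_corresp D e -> J2_corresp D' e' ->
  lin_equiv D D' -> e' = e \/ e' = - e.
Proof.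
move=> [e2 [m [_ De]]] [e2' [m' [_ De']]] DD'.
have [p [q sp]] := qpoly_root_split e2.
have [p' [q' sp']] := qpoly_root_split e2'.
move: De De'; rewrite (root_split_gen sp) (root_split_gen sp') => De De'.
have [a [b [a0 b0 /= /same_ideal_eq ab _]]] :=
  lin_equiv_trans (lin_equiv_sym De) (lin_equiv_trans DD' De').
have [p1 [p2 [q2 [sp2 ppE /same_ideal_eq IJ]]]] := root_split_mul fmon sp sp'.
have [fpq' cpq' _ _] := sp'.
have {}ab : ideal_scale (a * cx p1) (ramified_ideal p2) =
    ideal_scale (b * cx p') unit_ideal.
  rewrite -ideal_scaleA -IJ -ideal_scale_mull ab ideal_scale_mull -ideal_scaleA.
  by rewrite (same_ideal_eq (ramified_ideal_sqr fmon fpq' cpq')).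
have [p0' _] := monic_factor_neq0 fmon fpq'.
have p0 : p != 0 by case: sp => /(monic_factor_neq0 fmon) [].
have p10 : p1 != 0.
  by apply: contraTneq (mulf_neq0 p0 p0') => p10; rewrite ppE p10 expr0n mul0r eqxx.
have [fpq2 cpq2 pe2 qe2] := qpoly_mul_split sp2.
have fdv (s t x : A) : f = s * t -> size s = 1%N -> t %| x -> f %| x.
  move=> -> /eqP; rewrite size_poly_eq1 => s1.
  by rewrite (eqp_dvdl _ (_ : s * t %= t)) // -[X in _ %= X]mul1r eqp_mulr.
have E2 : e' = (e * e') * e by rewrite mulrAC -expr2 e2 mul1r.
have [] := @ramified_principal _ _ fmon fodd _ _ fpq2 cpq2 (a * cx p1) (b * cx p').
- by apply: curve_mul_neq0 => //; rewrite curve_x_eq0.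
- by apply: curve_mul_neq0 => //; rewrite curve_x_eq0.
- by rewrite ab.
- move=> s1; left; have /(in_qpoly_eqP fmon fsize) := fdv _ _ _ fpq2 s1 qe2.
  by rewrite in_qpolyK rmorph1 => ee; rewrite E2 ee mul1r.
move=> s1; right; have := fdv _ _ _ (etrans fpq2 (mulrC _ _)) s1 pe2.
rewrite -[X in _ + X]opprK => /(in_qpoly_eqP fmon fsize).
by rewrite in_qpolyK rmorphN rmorph1 => ee; rewrite E2 ee mulN1r.
Qed.

(** The roots e and -e give the same class since y (p, y) = p (q, y). *)
Lemma J2_corresp_sign D D' e e' : in_J2 D -> in_J2 D' ->
  J2_corresp D e -> J2_corresp D' e' -> e' = e \/ e' = - e -> lin_equiv D D'.
Proof.
move=> JD JD' cD cD'; have [p [q sp]] := qpoly_root_split (proj1 cD).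
have Dp := J2_correspE JD sp cD.
case=> Ee; rewrite Ee in cD' *.
  exact: lin_equiv_trans Dp (lin_equiv_sym (J2_correspE JD' sp cD')).
have sp' : root_split (- e : {poly %/ f}) q p.
  case: sp => fpq cpq pe qe; split; rewrite 1?coprimep_sym //.
  - by rewrite mulrC.
  - by rewrite -dvdpNr opprD opprK.
  - by rewrite -dvdpNr opprB addrC opprK.
apply: lin_equiv_trans Dp (lin_equiv_trans _ (lin_equiv_sym (J2_correspE JD' sp' cD'))).
have [fpq cpq pe qe] := sp.
have [p0 q0] := monic_factor_neq0 fmon fpq.
exists y, (cx p); split; [exact: curve_y_neq0 | by rewrite curve_x_eq0 | |].
  move=> z; rewrite /ramified_div /fst.
  split=> -[w]; rewrite /ramified_ideal => /dvdpP [s Es] ->.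
    exists (cx (ypart w * q) + cx s * y).
      by rewrite /ramified_ideal !curve_partE !(mul0r, mulr0, addr0) dvdp_mull.
    apply: curve_ext; rewrite !curve_partE ?Es; move: (ypart w) => v; last by ring.
    by rewrite [in LHS]fpq; ring.
  exists (cx (p * ypart w) + cx s * y).
    by rewrite /ramified_ideal !curve_partE !(mul0r, mulr0, addr0) dvdp_mulr.
  apply: curve_ext; rewrite !curve_partE ?Es; move: (ypart w) => v; last by ring.
  by rewrite [in RHS]fpq; ring.
rewrite /ramified_div /snd pole_order_x // pole_order_y // fpq size_mul //.
rewrite /= -addnn; move: p0 q0; rewrite -!size_poly_gt0; clear.
by move: (size p) (size q) => [|s] [|t] //=; lia.
Qed.
End JacobianTwoTorsion.

(** * Krylov subspaces *)

Section Krylov.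
Variables (F : fieldType) (N' : nat).
Notation N := N'.+1.
Variable T : 'M[F]_N.
Implicit Types (v w : 'rV[F]_N) (p q : {poly F}).

Local Notation "p .[T]" := (horner_mx T p) (at level 2, format "p .[T]").

Lemma expmxE i : T ^+ i = ('X^i).[T].
Proof. by rewrite rmorphXn /= horner_mx_X. Qed.

Lemma mul_hornerXn v p i : v *m (p * 'X^i).[T] = v *m p.[T] *m T ^+ i.
Proof. by rewrite rmorphM rmorphXn /= horner_mx_X mulmxA. Qed.

Lemma mul_hornerM v p q : v *m (p * q).[T] = v *m p.[T] *m q.[T].
Proof. by rewrite rmorphM /= mulmxA. Qed.

Lemma mul_hornerB v p q : v *m (p - q).[T] = v *m p.[T] - v *m q.[T].
Proof. by rewrite rmorphB mulmxBr. Qed.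

Definition krylov (v : 'rV[F]_N) k : 'M[F]_(k, N) := \matrix_(i < k) (v *m T ^+ i).

Lemma row_krylov v k (i : 'I_k) : row i (krylov v k) = v *m T ^+ i.
Proof. exact: rowK. Qed.

Lemma mul_krylov v k (c : 'rV_k) : c *m krylov v k = v *m horner_mx T (rVpoly c).
Proof.
rewrite mulmx_sum_row /rVpoly poly_def raddf_sum /= mulmx_sumr.
apply: eq_bigr => i _; rewrite row_krylov insubT // => lt.
rewrite linearZ /= rmorphXn /= horner_mx_X -scalemxAr.
by congr (c 0 _ *: _); apply: val_inj.
Qed.

Lemma krylovP v k w : reflect
  (exists2 p : {poly F}, (size p <= k)%N & w = v *m horner_mx T p) (w <= krylov v k)%MS.
Proof.
apply: (iffP submxP) => [[c ->]|[p sp ->]].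
  by exists (rVpoly c); rewrite ?mul_krylov // size_poly.
by exists (poly_rV p); rewrite mul_krylov poly_rV_K.
Qed.

Lemma krylov_subP v k m (W : 'M_(m, N)) :
  reflect (forall i, (i < k)%N -> (v *m T ^+ i <= W)%MS) (krylov v k <= W)%MS.
Proof.
apply: (iffP row_subP) => H i; last by rewrite row_krylov H.
by move=> ik; have := H (Ordinal ik); rewrite row_krylov.
Qed.

Lemma mulmxTS (v : 'rV[F]_N) i : v *m T ^+ i *m T = v *m T ^+ i.+1.
Proof. by rewrite -mulmxA exprSr. Qed.

Lemma krylov_stable v k (W : 'M_N) : (krylov v k <= W)%MS ->
  (v *m T ^+ k <= W)%MS -> (krylov v k *m T <= W)%MS.
Proof.
move=> /krylov_subP H Hk; apply/row_subP => i; rewrite row_mul row_krylov mulmxTS.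
have := ltn_ord i; rewrite leq_eqVlt => /predU1P [->//|lt]; exact: H.
Qed.

(** Cutting X down to the vectors that T keeps in X lowers the dimension by
    exactly one as long as X is not stable, so that X modulo its largest stable
    subspace is spanned by v, v T, v T^2 and so on: a single Kronecker block. *)
Lemma kronecker_chain k (X Y : 'M[F]_N) : stablemx Y T -> (Y <= X)%MS ->
  (forall Z : 'M_N, stablemx Z T -> (Z <= X)%MS -> (Z <= Y)%MS) ->
  (\rank (X + X *m T)%MS <= (\rank X).+1)%N -> \rank X = (\rank Y + k)%N ->
  exists v, (X == Y + krylov v k)%MS.
Proof.
move=> Yst; elim: k X => [|k IH] X YX maxY rX rk.
  have XY : (X <= Y)%MS by rewrite -(geq_leqif (mxrank_leqif_sup YX)) rk addn0.
  exists 0; rewrite (submx_trans XY) ?addsmxSl // addsmx_sub YX.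
  exact/krylov_subP.
pose X' := (X :&: kermx (T *m cokermx X))%MS.
have X'P m (W : 'M_(m, N)) : (W <= X')%MS = (W <= X)%MS && (W *m T <= X)%MS.
  by rewrite sub_capmx sub_kermx mulmxA submxE [in RHS]submxE.
have X'X : (X' <= X)%MS by apply: capmxSl.
have X'T : (X' *m T <= X)%MS by have := X'P _ X'; rewrite submx_refl => /esym/andP [].
have YX' : (Y <= X')%MS by rewrite X'P YX (submx_trans Yst).
have nst : ~~ (X <= X')%MS.
  apply/negP; rewrite X'P => /andP [_ /maxY/(_ (submx_refl _))/mxrankS].
  by rewrite rk addnS ltnNge leq_addr.
have rX' : \rank X = (\rank X').+1.
  apply/eqP; rewrite eqn_leq andbC (ltn_leqif (mxrank_leqif_sup X'X)) nst /=.
  have H1 := mxrank_mul_ker X (T *m cokermx X); rewrite mulmxA in H1.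
  have H2 := mxrank_mul_ker (X *m T) (cokermx X).
  have H3 : (\rank (X :&: X *m T)%MS <= \rank (X *m T :&: kermx (cokermx X))%MS)%N.
    by rewrite capmxC; apply/mxrankS/capmxS => //; rewrite sub_kermx mulmx_coker.
  have H4 := mxrank_sum_cap X (X *m T).
  rewrite -/X' in H1; lia.
have [v /eqmxP Xv] : exists v, (X' == Y + krylov v k)%MS.
  apply: IH => //.
  - by move=> Z Zst ZX'; apply: maxY => //; apply: submx_trans ZX' X'X.
  - by rewrite -rX'; apply: mxrankS; rewrite addsmx_sub X'X.
  - by apply/eqP; rewrite -eqSS -rX' rk addnS.
have fin (W : 'M_N) : (W <= X)%MS -> (X' <= W)%MS -> ~~ (W <= X')%MS -> (X == W)%MS.
  move=> WX X'W nW; rewrite andbC WX /= -(geq_leqif (mxrank_leqif_sup WX)) rX'.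
  by rewrite (ltn_leqif (mxrank_leqif_sup X'W)).
case: k IH rk Xv => [|k] IH rk Xv.
  have E : (X' == Y)%MS.
    by rewrite YX' Xv addsmx_sub submx_refl; apply/andP; split=> //; apply/krylov_subP.
  have /row_subPn [i ni] := nst; exists (row i X); apply: fin.
  - rewrite addsmx_sub YX; apply/krylov_subP => -[] // _.
    by rewrite expr0 mulmx1 row_sub.
  - by rewrite (eqmxP E) addsmxSl.
  apply: contra ni => /(submx_trans _); apply; apply: submx_trans (addsmxSr _ _).
  by apply/krylovP; exists 1; rewrite ?size_poly1 // rmorph1 mulmx1.
exists v.
have krX' : (krylov v k.+1 <= X')%MS by rewrite Xv addsmxSr.
apply: fin.
- rewrite addsmx_sub YX; apply/krylov_subP => i; rewrite ltnS leq_eqVlt.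
  move=> /predU1P [->|lt].
    rewrite -mulmxTS; apply: submx_trans X'T; apply: submxMr.
    by move/krylov_subP: krX'; apply.
  by apply: submx_trans X'X; move/krylov_subP: krX'; apply.
- rewrite Xv addsmx_sub addsmxSl; apply/krylov_subP => i lt.
  apply: submx_trans (addsmxSr _ _); apply/krylovP; exists 'X^i.
    by rewrite size_polyXn ltnW.
  by rewrite rmorphXn /= horner_mx_X.
apply/negP; rewrite addsmx_sub => /andP [_ H].
have /maxY : stablemx X' T.
  have XW : (X' <= Y + krylov v k.+1)%MS by rewrite Xv.
  apply: submx_trans (submxMr T XW) _.
  rewrite addsmxMr addsmx_sub (submx_trans Yst) //=.
  by apply: krylov_stable => //; move/krylov_subP: H; apply.
move=> /(_ X'X)/mxrankS; move: rk; rewrite rX'; clear; lia.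
Qed.
End Krylov.

(** * Isotropic subspaces for a self-adjoint operator *)

Section SelfAdjoint.
Variables (F : fieldType) (n : nat).
Notation N := n.*2.+1.
Variables (A T : 'M[F]_N).
Hypotheses (Asym : A^T = A) (Aunit : A \in unitmx) (TA : T *m A = A *m T^T).
Implicit Types (v w : 'rV[F]_N) (p q : {poly F}).
Notation "p .[T]" := (horner_mx T p) (at level 2, format "p .[T]").

Definition perp m (X : 'M[F]_(m, N)) : 'M_N := kermx (A *m X^T).

Lemma sub_perp m m' (Z : 'M_(m', N)) (X : 'M_(m, N)) :
  (Z <= perp X)%MS = (Z *m A *m X^T == 0).
Proof. by rewrite sub_kermx mulmxA. Qed.

Lemma sub_perpC m m' (Z : 'M_(m', N)) (X : 'M_(m, N)) :
  (Z <= perp X)%MS = (X <= perp Z)%MS.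
Proof. by rewrite !sub_perp -trmx_eq0 !trmx_mul trmxK Asym mulmxA. Qed.

Lemma rank_perp m (X : 'M_(m, N)) : \rank (perp X) = (N - \rank X)%N.
Proof.
by rewrite mxrank_ker eqmxMfull ?row_full_unit // mxrank_tr.
Qed.

Lemma perpS m m' (X : 'M_(m, N)) (Y : 'M_(m', N)) :
  (X <= Y)%MS -> (perp Y <= perp X)%MS.
Proof. by move=> XY; rewrite sub_perpC; apply: submx_trans XY _; rewrite sub_perpC. Qed.

Lemma isotropic_rank m (W : 'M_(m, N)) : (W <= perp W)%MS -> (\rank W <= n)%N.
Proof. by move/mxrankS; rewrite rank_perp; lia. Qed.

Lemma adjoint_horner p : p.[T] *m A = A *m p.[T]^T.
Proof.
elim/poly_ind: p => [|p c IH]; first by rewrite rmorph0 trmx0 mul0mx mulmx0.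
rewrite rmorphD rmorphM /= horner_mx_X horner_mx_C mulmxDl linearD /= mulmxDr.
congr (_ + _); last by rewrite tr_scalar_mx scalar_mxC.
have {1}-> : p.[T] * T = T *m p.[T] by apply: comm_horner_mx.
by rewrite trmx_mul -mulmxA IH !mulmxA TA.
Qed.

Lemma perp_stable (Y : 'M_N) p : stablemx Y T -> stablemx (perp Y) p.[T].
Proof.
move=> Yst; rewrite sub_perp.
have -> : perp Y *m p.[T] *m A *m Y^T = perp Y *m A *m (Y *m p.[T])^T.
  by rewrite trmx_mul -(mulmxA _ p.[T]) adjoint_horner !mulmxA.
by rewrite -sub_perp perpS // horner_mx_stable.
Qed.

Lemma adjoint_powers v i j :
  v *m T ^+ i *m A *m (v *m T ^+ j)^T = v *m T ^+ (i + j) *m A *m v^T.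
Proof.
rewrite trmx_mul mulmxA exprD mulmxA; congr (_ *m _).
have := adjoint_horner 'X^j; rewrite rmorphXn /= horner_mx_X => E.
by rewrite -mulmxA -E mulmxA.
Qed.

Section NormalForm.
Variables X Y : 'M[F]_N.
Hypotheses (rX : \rank X = n) (XX : (X <= perp X)%MS) (XT : (X *m T <= perp X)%MS).
Hypotheses (Yst : stablemx Y T) (YX : (Y <= X)%MS).
Hypothesis maxY : forall Z : 'M_N, stablemx Z T -> (Z <= X)%MS -> (Z <= Y)%MS.

Let n1 := (n - \rank Y)%N.

Let rY : \rank X = (\rank Y + n1)%N.
Proof. by have := mxrankS YX; rewrite rX /n1; lia. Qed.

(** The vanishing expresses that X and X T are orthogonal to X. A vector of
    perp X of square 0 lies in X, because isotropic subspaces have dimension at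
    most n. So if the last pairing vanished, v T^n1 would be in X and X would be
    stable. *)
Lemma isotropic_normal_form : exists v : 'rV_N, [/\
  (X == Y + krylov T v n1)%MS, (v <= perp Y)%MS,
  forall j, (j < n1.*2)%N -> v *m T ^+ j *m A *m v^T = 0 &
  v *m T ^+ n1.*2 *m A *m v^T != 0].
Proof.
have iso v : (v <= perp X)%MS -> v *m A *m v^T = 0 -> (v <= X)%MS.
  move=> vX v0; have WX : (X <= X + v)%MS by apply: addsmxSl.
  have : (X + v <= perp (X + v)%MS)%MS.
    have vW : (v <= perp (X + v)%MS)%MS.
      by rewrite sub_perpC addsmx_sub -sub_perpC vX sub_perp v0 eqxx.
    by rewrite addsmx_sub vW andbT sub_perpC addsmx_sub XX.
  move/isotropic_rank => rW; have : (\rank (X + v)%MS <= \rank X)%N by rewrite rX.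
  by rewrite (geq_leqif (mxrank_leqif_sup WX)) addsmx_sub => /andP [].
(* If X = Y, any vector of perp X outside X will do. *)
case E : n1 => [|k].
  have XY : (X <= Y)%MS by rewrite -(geq_leqif (mxrank_leqif_sup YX)) rY E addn0.
  have /row_subPn [i vX] : ~~ (perp X <= X)%MS.
    by apply/negP => /mxrankS; rewrite rank_perp rX; lia.
  have vp : (row i (perp X) <= perp X)%MS by apply: row_sub.
  exists (row i (perp X)); split=> //.
  - rewrite addsmx_sub YX (submx_trans XY) ?addsmxSl //=; exact/krylov_subP.
  - exact: submx_trans vp (perpS YX).
  - by rewrite expr0 mulmx1; apply: contra vX => /eqP; apply: iso.
have rXT : (\rank (X + X *m T)%MS <= (\rank X).+1)%N.
  have : (X + X *m T <= perp X)%MS by rewrite addsmx_sub XX.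
  by move/mxrankS; rewrite rank_perp rX; lia.
have [v Xv] := kronecker_chain Yst YX maxY rXT rY; rewrite -/n1 E in Xv.
have vT i : (i <= k)%N -> (v *m T ^+ i <= X)%MS.
  by move=> ik; rewrite (eqmxP Xv); apply: submx_trans (addsmxSr _ _);
     have /krylov_subP := submx_refl (krylov T v k.+1); apply.
have phi0 j : (j < k.+1.*2)%N -> v *m T ^+ j *m A *m v^T = 0.
  move=> jk; pose i := minn j k.+1.
  have -> : j = (i + (j - i))%N by rewrite subnKC // geq_minl.
  rewrite -adjoint_powers; apply/eqP; rewrite -sub_perp.
  have vp : (v *m T ^+ i <= perp X)%MS.
    rewrite /i; case: (ltnP j k.+1) => jk1; first exact: submx_trans (vT _ jk1) XX.
    by rewrite -mulmxTS; apply: submx_trans XT; apply/submxMr/vT.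
  apply: submx_trans vp (perpS _); apply: vT.
  by rewrite /i; move: jk; clear; lia.
have v_X : (v <= X)%MS by have := vT 0%N isT; rewrite expr0 mulmx1.
exists v; split=> //; first exact: submx_trans v_X (submx_trans XX (perpS YX)).
apply/negP => /eqP v0; have : stablemx X T.
  have XW : (X <= Y + krylov T v k.+1)%MS by rewrite (eqmxP Xv).
  have WX : (Y + krylov T v k.+1 <= X)%MS by rewrite (eqmxP Xv).
  apply: submx_trans (submxMr T XW) _.
  rewrite addsmxMr addsmx_sub (submx_trans Yst) //=.
  apply: krylov_stable; first by apply: submx_trans WX; apply: addsmxSr.
  apply: iso; last by rewrite adjoint_powers addnn.
  by rewrite -mulmxTS; apply: submx_trans XT; apply/submxMr/vT.
move/maxY/(_ (submx_refl _))/mxrankS; rewrite rY E; lia.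
Qed.
End NormalForm.
End SelfAdjoint.

(** * The cyclic quotient perp Y / Y *)

Section Cyclic.
Variables (F : fieldType) (n : nat).
Notation N := n.*2.+1.
Variables (A T : 'M[F]_N).
Hypotheses (Asym : A^T = A) (Aunit : A \in unitmx) (TA : T *m A = A *m T^T).
Implicit Types (v w : 'rV[F]_N) (p q u : {poly F}).
Notation "p .[T]" := (horner_mx T p) (at level 2, format "p .[T]").
Notation perp := (perp A).

(** What the normal form of a maximal isotropic X remembers of X modulo its
    largest stable subspace Y. *)
Definition cyclic_vector (Y : 'M_N) v n1 := [/\ (v <= perp Y)%MS,
  forall j, (j < n1.*2)%N -> v *m T ^+ j *m A *m v^T = 0 &
  v *m T ^+ n1.*2 *m A *m v^T != 0].

Section Fixed.
Variables (Y : 'M[F]_N) (v : 'rV[F]_N) (n1 : nat).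
Hypotheses (Yst : stablemx Y T) (YY : (Y <= perp Y)%MS).
Hypotheses (rY : (\rank Y + n1 = n)%N) (cyc : cyclic_vector Y v n1).

(** Only the leading term of p survives: the Hankel matrix of the pairings of
    the v T^i is triangular with respect to the antidiagonal. *)
Lemma cyclic_lead p : (size p <= n1.*2.+1)%N ->
  v *m p.[T] *m T ^+ (n1.*2 - (size p).-1) *m A *m v^T =
  lead_coef p *: (v *m T ^+ n1.*2 *m A *m v^T).
Proof.
have [_ phi0 _] := cyc.
have [->|p0] := eqVneq p 0.
  by rewrite rmorph0 mulmx0 !mul0mx lead_coef0 scale0r.
move=> sp; set k := (n1.*2 - _)%N.
have Ek : ((size p).-1 + k = n1.*2)%N.
  by rewrite subnKC // -ltnS -polySpred.
rewrite -mul_hornerXn -[p in LHS]coefK poly_def mulr_suml rmorph_sum /=.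
rewrite (polySpred p0) big_ord_recr /= mulmxDr !mulmxDl mulmx_sumr !mulmx_suml.
rewrite big1 ?add0r => [|i _]; rewrite -scalerAl -exprD linearZ /= rmorphXn /=.
  by rewrite Ek horner_mx_X -!scalemxAr -!scalemxAl.
rewrite horner_mx_X -!scalemxAr -!scalemxAl.
by rewrite phi0 ?scaler0 // -Ek ltn_add2r.
Qed.

Lemma cyclic_free p : (size p <= n1.*2.+1)%N ->
  (forall j, (j <= n1.*2)%N -> v *m p.[T] *m T ^+ j *m A *m v^T = 0) -> p = 0.
Proof.
have [_ _ phi1] := cyc; move=> sp H; apply/eqP; rewrite -lead_coef_eq0.
have := cyclic_lead sp; rewrite H ?leq_subr // => /esym/eqP.
by rewrite scaler_eq0 (negPf phi1) orbF.
Qed.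

Lemma cyclic_orthogonal w j : (w <= Y)%MS -> w *m T ^+ j *m A *m v^T = 0.
Proof.
have [vp _ _] := cyc; move=> wY.
have wTY : (w *m T ^+ j <= Y)%MS.
  apply: submx_trans (submxMr _ wY) _; rewrite expmxE.
  exact: horner_mx_stable.
apply/eqP; rewrite -sub_perp sub_perpC //.
by apply: submx_trans vp _; apply: perpS.
Qed.

Lemma cyclic_free_mod p : (size p <= n1.*2.+1)%N -> (v *m p.[T] <= Y)%MS -> p = 0.
Proof. by move=> sp pY; apply: cyclic_free sp _ => j _; apply: cyclic_orthogonal. Qed.

(** The vectors v T^j with j <= 2 n1 are independent modulo Y, and their number
    is the dimension of perp Y / Y. *)
Lemma cyclic_perp : (perp Y == Y + krylov T v n1.*2.+1)%MS.
Proof.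
have [vp _ _] := cyc; set K := krylov T v _.
have sub : (Y + K <= perp Y)%MS.
  rewrite addsmx_sub YY; apply/krylov_subP => j _.
  apply: submx_trans (submxMr _ vp) _; rewrite expmxE.
  exact: perp_stable.
rewrite andbC sub -(geq_leqif (mxrank_leqif_sup sub)) rank_perp //.
have cap0 : (Y :&: K)%MS = 0.
  apply/eqP/rowV0P => w; rewrite sub_capmx => /andP [wY /krylovP [p sp wE]].
  by move: wY; rewrite wE => /(cyclic_free_mod sp) ->; rewrite rmorph0 mulmx0.
have rK : \rank K = n1.*2.+1.
  apply/eqP/row_freeP; apply/row_freeP; rewrite -kermx_eq0; apply/rowV0P => c.
  rewrite sub_kermx mul_krylov => /eqP E.
  rewrite -[c]rVpolyK (cyclic_free_mod (p := rVpoly c)) ?size_poly ?raddf0 //.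
  by rewrite E sub0mx.
by rewrite mxrank_disjoint_sum // rK; move: rY; clear; lia.
Qed.

Lemma cyclic_repr w : (w <= perp Y)%MS ->
  exists2 p : {poly F}, (size p <= n1.*2.+1)%N & (w - v *m p.[T] <= Y)%MS.
Proof.
rewrite (eqmxP cyclic_perp) => /sub_addsmxP [[a b] /= ->].
have /krylovP [p sp ->] := submxMl b (krylov T v n1.*2.+1).
by exists p; rewrite // addrK submxMl.
Qed.

(** The annihilator of v modulo Y is the minimal polynomial of T on perp Y / Y. *)
Lemma cyclic_modulus : exists g : {poly F}, [/\ g \is monic, size g = n1.*2.+2 &
  forall p, (v *m p.[T] <= Y)%MS = (g %| p)].
Proof.
have [vp _ _] := cyc.
have : (v *m ('X^(n1.*2.+1)).[T] <= perp Y)%MS.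
  by apply: submx_trans (submxMr _ vp) _; apply: perp_stable.
case/cyclic_repr=> u su; rewrite -mul_hornerB; set g := _ - u => gY.
have lt : (size (- u)%R < size ('X^(n1.*2.+1) : {poly F}))%N.
  by rewrite size_polyN size_polyXn.
have gmon : g \is monic by rewrite monicE lead_coefDl // lead_coefXn.
have sg : size g = n1.*2.+2 by rewrite size_polyDl // size_polyXn.
have gM p : (v *m (p * g).[T] <= Y)%MS.
  rewrite mulrC mul_hornerM; apply: submx_trans (submxMr _ gY) _.
  exact: horner_mx_stable.
exists g; split=> // p; apply/idP/idP => [pY|/dvdpP [q ->]]; last exact: gM.
apply/eqP; apply: cyclic_free_mod.
  by rewrite -ltnS -sg ltn_modp monic_neq0.
have -> : p %% g = p - p %/ g * g by rewrite {2}(divp_eq p g) addrC addKr.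
by rewrite mul_hornerB addmx_sub // eqmx_opp.
Qed.
End Fixed.
End Cyclic.

(** * Isometries e(T) over the field of definition *)

(** The square root of a scalar u^2 modulo g is found by taking norms, that is
    determinants: the degree of g is odd. *)
Lemma sqr_mod_odd (F : fieldType) (g u : {poly F}) (c : F) k :
  g \is monic -> size g = k.*2.+2 -> g %| u ^+ 2 - c%:P -> exists s, s ^+ 2 = c.
Proof.
move=> gmon sg gu; have [C CE] : exists C : 'M[F]_k.*2.+1, char_poly C = g.
  have := companionmxK gmon; move: (companionmx g); rewrite sg => C CE.
  by exists C.
pose M := horner_mx C u.
have M2 : M * M = c%:M.
  rewrite -rmorphM /= -expr2 -(subrK c%:P (u ^+ 2)) rmorphD /= horner_mx_C.
  have /dvdpP [w ->] := gu; rewrite rmorphM /= -CE Cayley_Hamilton mulr0 add0r.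
  by [].
have D2 : (\det M) ^+ 2 = c ^+ k.*2.+1.
  by rewrite expr2 -det_mulmx -[M *m M]/(M * M) M2 det_scalar.
have [->|c0] := eqVneq c 0; first by exists 0; rewrite expr0n.
exists (\det M / c ^+ k); rewrite expr_div_n D2 -exprM muln2 exprS.
by rewrite mulfK // expf_neq0.
Qed.

(** With g = p q according to the signs of e, let s be the largest divisor of f
    prime to q. It is divisible by p, it is prime to t = f / s, which is
    divisible by q; so the signs -1 modulo s and 1 modulo t extend those of e. *)
Lemma root_of_unity_lift (F : fieldType) (f g e : {poly F}) : (2%:R : F) != 0 ->
  f != 0 -> g \is monic -> g %| f -> g %| e ^+ 2 - 1 ->
  exists2 e', f %| e' ^+ 2 - 1 & g %| e' - e.
Proof.
move=> two f0 gmon gf /(root_split_exists gmon two) [p [q [gE cpq pe qe]]].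
have qf : q %| f by apply: dvdp_trans gf; rewrite gE dvdp_mull.
have pf : p %| f by apply: dvdp_trans gf; rewrite gE dvdp_mulr.
case: (gdcopP q f) => s sf; rewrite (negPf f0) orbF => csq max.
have /dvdpP [t Ef] := sf.
have s0 : s != 0 by apply: contraNneq f0 => s0; rewrite Ef s0 mulr0.
have cts : coprimep t s.
  have : gcdp t s * s %| s.
    apply: max; first by rewrite Ef dvdp_mul2r // dvdp_gcdl.
    rewrite coprimepMl csq andbT; apply: coprimep_dvdr csq; exact: dvdp_gcdr.
  by rewrite -[X in _ %| X]mul1r dvdp_mul2r // dvdp1 -coprimep_def.
have qt : q %| t.
  by rewrite -(@Gauss_dvdpl _ _ s) -?Ef // coprimep_sym.
have ps : p %| s by apply: max.
have /Bezout_eq1_coprimepP [[a b] /= ab] := cts.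
exists (b * s - a * t).
  have -> : (b * s - a * t) ^+ 2 - 1 = (b * s - a * t) ^+ 2 - (a * t + b * s) ^+ 2.
    by rewrite ab expr1n.
  rewrite Ef (_ : _ - _ = - (4%:R * a * b) * (t * s)); last by ring.
  by rewrite dvdp_mull.
rewrite gE Gauss_dvdp //; apply/andP; split.
  have -> : b * s - a * t - e = (b + b) * s - (e + (a * t + b * s)) by ring.
  by rewrite ab dvdp_sub // dvdp_mull.
have -> : b * s - a * t - e = (- (a + a)) * t - (e - (a * t + b * s)) by ring.
by rewrite ab dvdp_sub // dvdp_mull.
Qed.

Section Isometries.
Variables (F : fieldType) (n : nat).
Notation N := n.*2.+1.
Variables (A T : 'M[F]_N).
Hypotheses (Asym : A^T = A) (Aunit : A \in unitmx) (TA : T *m A = A *m T^T).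
Hypothesis two_neq0 : (2%:R : F) != 0.
Implicit Types (v w : 'rV[F]_N) (e p q u : {poly F}).
Notation "p .[T]" := (horner_mx T p) (at level 2, format "p .[T]").
Notation perp := (perp A).

Definition isotropic_over (Y X : 'M_N) := [/\ \rank X = n,
  (X <= perp X)%MS, (X *m T <= perp X)%MS,
  (Y <= X)%MS & forall Z : 'M_N, stablemx Z T -> (Z <= X)%MS -> (Z <= Y)%MS].

Variable Y : 'M[F]_N.
Hypothesis Yst : stablemx Y T.

Lemma horner_mulmxC p i : p.[T] *m T ^+ i = T ^+ i *m p.[T].
Proof. by rewrite expmxE; apply: comm_horner_mx2. Qed.

Lemma isotropic_over_Y X : isotropic_over Y X -> (Y <= perp Y)%MS.
Proof.
by case=> _ XX _ YX _; apply: submx_trans YX (submx_trans XX (perpS Asym YX)).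
Qed.

Lemma isotropic_over_rank X : isotropic_over Y X -> (\rank Y + (n - \rank Y) = n)%N.
Proof. by case=> rX _ _ YX _; have := mxrankS YX; rewrite rX; apply: subnKC. Qed.

Lemma isotropic_over_cyclic X : isotropic_over Y X -> exists2 v : 'rV_N,
  cyclic_vector A T Y v (n - \rank Y) & (X == Y + krylov T v (n - \rank Y))%MS.
Proof.
case=> rX XX XT YX maxY.
have [v [Xv vp phi0 phi1]] :=
  isotropic_normal_form Asym Aunit TA rX XX XT Yst YX maxY.
by exists v.
Qed.

Lemma root_of_unity_unit e : char_poly T %| e ^+ 2 - 1 -> e.[T] *m e.[T] = 1%:M.
Proof.
case/dvdpP=> w E; rewrite -[e.[T] *m _]/(e.[T] * e.[T]) -rmorphM /= -expr2.
rewrite -(subrK 1 (e ^+ 2)) E rmorphD rmorphM /= Cayley_Hamilton mulr0 add0r.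
by rewrite rmorph1.
Qed.

Lemma sub_horner_congr v p q g : (forall r, (v *m r.[T] <= Y)%MS = (g %| r)) ->
  g %| p - q -> (v *m p.[T] - v *m q.[T] <= Y)%MS.
Proof. by move=> gP gpq; rewrite -mul_hornerB gP. Qed.

Lemma submx_subr m k (u1 u2 : 'M[F]_(m, N)) (W : 'M_(k, N)) :
  (u1 - u2 <= W)%MS -> (u2 <= W)%MS -> (u1 <= W)%MS.
Proof. by move=> h1 h2; rewrite -(subrK u2 u1) addmx_sub. Qed.

(** Both subspaces are generated over Y by cyclic vectors, v and v' = v u(T).
    The pairings of v' with the v' T^j are those of v u(T)^2 with the v T^j; like
    those of v, they vanish for j < 2 n1, so u^2 is a scalar c modulo the
    annihilator of v. The degree of the annihilator is odd, so c is a square s^2,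
    and u / s is a square root of 1 taking v to v' / s. *)
Lemma isotropic_transitive X X' : isotropic_over Y X -> isotropic_over Y X' ->
  exists2 e, char_poly T %| e ^+ 2 - 1 & (X' == X *m e.[T])%MS.
Proof.
move=> HX HX'; have YY := isotropic_over_Y HX; have rY := isotropic_over_rank HX.
have [v cyc Xv] := isotropic_over_cyclic HX.
have [v' cyc' Xv'] := isotropic_over_cyclic HX'.
set k := (n - \rank Y)%N in rY cyc cyc' Xv Xv'.
have [g [gmon sg gP]] := cyclic_modulus Asym Aunit TA Yst YY rY cyc.
have [vp phi0 phi1] := cyc; have [vp' phi0' phi1'] := cyc'.
have [u su vu] := cyclic_repr Asym Aunit TA Yst YY rY cyc vp'.
have phiE j : v' *m T ^+ j *m A *m v'^T = v *m (u ^+ 2).[T] *m T ^+ j *m A *m v^T.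
  have orth w w' : (w <= perp Y)%MS -> (w' <= Y)%MS ->
      w *m T ^+ j *m A *m w'^T = 0 /\ w' *m T ^+ j *m A *m w^T = 0.
    move=> wp wY; have perpT z : (z <= Y)%MS -> (z *m T ^+ j <= Y)%MS.
      move=> zY; apply: submx_trans (submxMr _ zY) _.
      by rewrite expmxE; apply: horner_mx_stable.
    split; apply/eqP; rewrite -sub_perp.
      apply: (@submx_trans _ _ _ _ _ _ (perp Y)); last exact: perpS.
      apply: submx_trans (submxMr _ wp) _; rewrite expmxE; exact: perp_stable.
    rewrite sub_perpC //; apply: submx_trans wp _; apply: perpS => //; exact: perpT.
  have vup : (v *m u.[T] <= perp Y)%MS.
    by apply: submx_trans (submxMr _ vp) _; apply: perp_stable.
  have [z zY ->] : exists2 z, (z <= Y)%MS & v' = v *m u.[T] + z.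
    by exists (v' - v *m u.[T]); rewrite // addrC subrK.
  have [o1 o2] := orth _ _ vup zY; have [o3 _] := orth _ _ (submx_trans zY YY) zY.
  rewrite !mulmxDl linearD /= !mulmxDr o1 o2 o3 !addr0 trmx_mul mulmxA.
  congr (_ *m _); rewrite -!mulmxA -(adjoint_horner TA) !mulmxA; congr (_ *m _).
  by rewrite -[_ *m T ^+ j *m _]mulmxA -horner_mulmxC mulmxA -mul_hornerM -expr2.
(* the ratio of the only pairings that do not vanish *)
pose c := (v' *m T ^+ k.*2 *m A *m v'^T) 0 0 / (v *m T ^+ k.*2 *m A *m v^T) 0 0.
have scal0 (M : 'M[F]_1) : M != 0 -> M 0 0 != 0.
  by apply: contraNneq => M0; rewrite [M]mx11_scalar M0 raddf0.
have c0 : c != 0 by rewrite mulf_neq0 ?invr_neq0 // scal0.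
have gu : g %| u ^+ 2 - c%:P.
  apply/eqP; apply: (cyclic_free cyc).
    by rewrite -ltnS -sg ltn_modp monic_neq0.
  move=> j jk.
  have : (v *m (u ^+ 2 - c%:P).[T] - v *m ((u ^+ 2 - c%:P) %% g).[T] <= Y)%MS.
    apply: sub_horner_congr gP _.
    by rewrite {1}(divp_eq (u ^+ 2 - c%:P) g) addrK dvdp_mull.
  move/(cyclic_orthogonal Asym Yst cyc j); rewrite !mulmxBl => /eqP.
  rewrite subr_eq0 => /eqP <-; rewrite mul_hornerB !mulmxBl -phiE horner_mx_C.
  rewrite mul_mx_scalar -!scalemxAl; apply/eqP; rewrite subr_eq0; apply/eqP.
  have [jk2|kj] := ltnP j k.*2; first by rewrite phi0 // phi0' // scaler0.
  have -> : j = k.*2 by apply/eqP; rewrite eqn_leq jk.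
  rewrite [LHS]mx11_scalar [in RHS](mx11_scalar (v *m _ *m _ *m _)) scale_scalar_mx.
  by rewrite divfK // scal0.
have [s sE] := sqr_mod_odd gmon sg gu.
have s0 : s != 0 by apply: contraNneq c0 => s0; rewrite -sE s0 expr0n.
have ge : g %| (s^-1 *: u) ^+ 2 - 1.
  rewrite (_ : _ - 1 = s^-1 ^+ 2 *: (u ^+ 2 - c%:P)) ?dvdpZr ?expf_neq0 ?invr_neq0 //.
  rewrite scalerBr exprZn; congr (_ - _).
  by rewrite -sE scale_polyC -exprMn mulVf // expr1n.
have gT : g %| char_poly T by rewrite -gP Cayley_Hamilton mulmx0 sub0mx.
have chi0 := monic_neq0 (char_poly_monic T).
have [e fe eu] := root_of_unity_lift two_neq0 chi0 gmon gT ge.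
exists e => //; have [rX _ _ _ _] := HX; have [rX' _ _ YX' _] := HX'.
have eu' : e.[T] \in unitmx by case/mulmx1_unit: (root_of_unity_unit fe).
have sub : (X *m e.[T] <= X')%MS.
  have XW : (X <= Y + krylov T v k)%MS by case/andP: Xv.
  apply: submx_trans (submxMr _ XW) _; rewrite addsmxMr addsmx_sub.
  rewrite (submx_trans (horner_mx_stable e Yst) YX') /=.
  apply/row_subP => i; rewrite row_mul row_krylov -mulmxA -horner_mulmxC mulmxA.
  have YT z : (z <= Y)%MS -> (z *m T ^+ i <= X')%MS.
    move=> zY; apply: submx_trans (submxMr _ zY) _.
    by rewrite expmxE; apply: submx_trans YX'; apply: horner_mx_stable.
  apply: (@submx_subr _ _ _ (s^-1 *: v' *m T ^+ i)).
    rewrite -mulmxBl; apply: YT.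
    have -> : v *m e.[T] - s^-1 *: v' =
        (v *m e.[T] - v *m (s^-1 *: u).[T]) - s^-1 *: (v' - v *m u.[T]).
      by rewrite horner_mxZ -scalemxAr scalerBr opprB addrA subrK.
    by rewrite addmx_sub ?eqmx_opp ?scalemx_sub // (sub_horner_congr gP).
  rewrite -scalemxAl scalemx_sub // (eqmxP Xv'); apply: submx_trans (addsmxSr _ _).
  by have /krylov_subP := submx_refl (krylov T v' k); apply.
rewrite sub andbT -(geq_leqif (mxrank_leqif_sup sub)).
by rewrite mxrankMfree ?row_free_unit // rX rX'.
Qed.

(** An isometry e(T) fixing X preserves the flag spanned over Y by the powers of
    T on v, hence fixes v up to a scalar modulo Y. *)
Lemma isotropic_stabilizer X e : isotropic_over Y X -> (X == X *m e.[T])%MS ->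
  exists l : F, (perp Y *m (e - l%:P).[T] <= Y)%MS.
Proof.
move=> HX Xe; have YY := isotropic_over_Y HX; have rY := isotropic_over_rank HX.
have [v cyc Xv] := isotropic_over_cyclic HX.
set k := (n - \rank Y)%N in rY cyc Xv.
have [g [gmon sg gP]] := cyclic_modulus Asym Aunit TA Yst YY rY cyc.
have [vp phi0 phi1] := cyc.
have XeX : (X *m e.[T] <= X)%MS by case/andP: Xe.
suff [l gl] : exists l : F, g %| e - l%:P.
  exists l; apply/row_subP => i; rewrite row_mul.
  have [p _ wp] := cyclic_repr Asym Aunit TA Yst YY rY cyc (row_sub i (perp Y)).
  apply: (@submx_subr _ _ _ (v *m p.[T] *m (e - l%:P).[T])).
    by rewrite -mulmxBl; apply: submx_trans (submxMr _ wp) _; apply: horner_mx_stable.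
  by rewrite -mul_hornerM gP dvdp_mull.
have repr w : (w <= X)%MS ->
    exists2 p : {poly F}, (size p <= k)%N & (w - v *m p.[T] <= Y)%MS.
  rewrite (eqmxP Xv) => /sub_addsmxP [[a b] /= ->].
  have /krylovP [p sp ->] := submxMl b (krylov T v k).
  by exists p; rewrite // addrK submxMl.
(* For k = 0 the generator v is not in X but spans perp Y modulo Y. *)
have [u su gu] : exists2 u : {poly F}, (size u <= maxn k 1)%N & g %| e - u.
  have [k0|k0] := posnP k.
    have vep : (v *m e.[T] <= perp Y)%MS.
      by apply: submx_trans (submxMr _ vp) _; apply: perp_stable.
    have [u su vu] := cyclic_repr Asym Aunit TA Yst YY rY cyc vep.
    exists u; first by move: su; rewrite k0.
    by rewrite -gP mul_hornerB.
  have vX : (v <= X)%MS.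
    rewrite (eqmxP Xv); apply: submx_trans (addsmxSr _ _).
    by apply/krylovP; exists 1; rewrite ?size_poly1 // rmorph1 mulmx1.
  have [u su vu] := repr _ (submx_trans (submxMr _ vX) XeX).
  by exists u; [apply: leq_trans su (leq_maxl _ _) | rewrite -gP mul_hornerB].
have [su1|su1] := leqP (size u) 1.
  by exists u`_0; rewrite -size1_polyC.
have k1 : (1 < k)%N by move: su su1; clear; lia.
have sk : (size u <= k)%N by move: su su1; clear; lia.
(* If u is not constant, this power brings u x^j to degree k exactly, although
   v T^j e(T) is still in X. *)
pose j := (k.+1 - size u)%N.
have jk : (j < k)%N by rewrite /j; move: su1 k1; clear; lia.
have vTX : (v *m T ^+ j <= X)%MS.
  rewrite (eqmxP Xv); apply: submx_trans (addsmxSr _ _).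
  by have /krylov_subP := submx_refl (krylov T v k); apply.
have [w sw vw] := repr _ (submx_trans (submxMr _ vTX) XeX).
have u0 : u != 0 by rewrite -size_poly_gt0 ltnW.
have : g %| u * 'X^j - w.
  rewrite (_ : _ - w = (e * 'X^j - w) - (e - u) * 'X^j); last by ring.
  rewrite dvdp_sub // ?dvdp_mulr // -gP mul_hornerB mul_hornerXn.
  by rewrite -mulmxA horner_mulmxC mulmxA.
have sX : size (u * 'X^j) = k.+1.
  by rewrite size_mulXn // /j addnC subnKC // ltnW.
have sB : size (u * 'X^j - w) = k.+1.
  by rewrite size_polyDl ?sX // size_polyN ltnS.
have nz : u * 'X^j - w != 0 by rewrite -size_poly_gt0 sB.
move/(dvdp_leq nz); rewrite sB sg; clear; lia.
Qed.
End Isometries.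

(** * Stable subspaces of a regular operator *)

Section RegularOperator.
Variables (K : fieldType) (N' : nat).
Notation N := N'.+1.
Variables (T : 'M[K]_N) (s : nat) (alpha : 'I_s -> K) (m : 'I_s -> nat).
Hypotheses (alpha_inj : injective alpha).
Implicit Types (c d : 'I_s -> nat) (p q : {poly K}).
Notation "p .[T]" := (horner_mx T p) (at level 2, format "p .[T]").

Definition root_prod c : {poly K} := \prod_(i < s) ('X - (alpha i)%:P) ^+ c i.

Hypothesis charT : char_poly T = root_prod m.
Hypothesis regT : forall i, (\rank (kermx (T - (alpha i)%:M)) <= 1)%N.

Lemma sub_kermxpoly k (W : 'M_(k, N)) p : (W <= kermxpoly T p)%MS = (W *m p.[T] == 0).
Proof. exact: sub_kermx. Qed.

Lemma kermxpoly_stable p : stablemx (kermxpoly T p) T.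
Proof. exact: comm_mx_stable_kermxpoly. Qed.

Lemma kermxpoly_dvd p q : p %| q -> (kermxpoly T p <= kermxpoly T q)%MS.
Proof.
case/dvdpP=> w ->; rewrite sub_kermxpoly mulrC rmorphM mulmxA.
have /eqP -> : kermxpoly T p *m p.[T] == 0 by rewrite -sub_kermxpoly.
by rewrite mul0mx.
Qed.

Lemma rank_kermxpolyE p : \rank (kermxpoly T p) = (N - \rank p.[T])%N.
Proof. exact: mxrank_ker. Qed.

Lemma rank_kermxpolyM p q :
  (\rank (kermxpoly T (p * q)) <= \rank (kermxpoly T p) + \rank (kermxpoly T q))%N.
Proof.
rewrite !rank_kermxpolyE.
have E : \rank (p * q).[T] = \rank (p.[T] *m q.[T]) by rewrite rmorphM.
have := mxrank_mul_min p.[T] q.[T]; rewrite -E.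
move: (\rank (p * q).[T]) (rank_leq_row p.[T]) (rank_leq_row q.[T]) => c.
move: (\rank p.[T]) (\rank q.[T]) => a b; clear; set N := N'.+1.
lia.
Qed.

Lemma rank_kermxpoly_exp i k : (\rank (kermxpoly T (('X - (alpha i)%:P) ^+ k)) <= k)%N.
Proof.
elim: k => [|k IH]; first by rewrite expr0 kermxpoly1 mxrank0.
rewrite exprSr; apply: leq_trans (rank_kermxpolyM _ _) _.
rewrite -[leqRHS]addn1 leq_add // /kermxpoly rmorphB /= horner_mx_X horner_mx_C.
exact: regT.
Qed.

Lemma rank_kermxpoly_le c : (\rank (kermxpoly T (root_prod c)) <= \sum_i c i)%N.
Proof.
rewrite /root_prod; elim/big_rec2: _ => [|i k p _ IH].
  by rewrite kermxpoly1 mxrank0.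
apply: leq_trans (rank_kermxpolyM _ _) (leq_add _ IH); exact: rank_kermxpoly_exp.
Qed.

Lemma root_prodD c d : root_prod (fun i => c i + d i)%N = root_prod c * root_prod d.
Proof. by rewrite -big_split; apply: eq_bigr => i _; rewrite exprD. Qed.

Lemma root_prod_sub c d : (forall i, c i <= d i)%N ->
  root_prod d = root_prod c * root_prod (fun i => d i - c i)%N.
Proof.
by move=> cd; rewrite -root_prodD; apply: eq_bigr => i _; rewrite subnKC.
Qed.

Lemma root_prod_dvd c d : (forall i, c i <= d i)%N -> root_prod c %| root_prod d.
Proof. by move/root_prod_sub ->; apply: dvdp_mulr. Qed.

Lemma size_root_prod c : size (root_prod c) = (\sum_i c i).+1.
Proof.
rewrite /root_prod.
suff [] : size (\prod_(i < s) ('X - (alpha i)%:P) ^+ c i) = (\sum_i c i).+1 /\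
   \prod_(i < s) ('X - (alpha i)%:P) ^+ c i \is monic by [].
elim/big_rec2: _ => [|i k p _ [sp mp]]; first by rewrite size_poly1 monic1.
have mi : ('X - (alpha i)%:P) ^+ c i \is monic by apply/monic_exp/monicXsubC.
rewrite monicMl // mp; split=> //.
by rewrite size_Mmonic ?monic_neq0 // sp size_exp_XsubC addnS.
Qed.

Lemma sum_mult : (\sum_i m i)%N = N.
Proof. by have := size_char_poly T; rewrite charT size_root_prod => -[]. Qed.

(** Regularity makes the dimensions of kernels as large as for a cyclic module:
    the kernels of two complementary factors bound each other. *)
Lemma rank_kermxpoly c : (forall i, c i <= m i)%N ->
  \rank (kermxpoly T (root_prod c)) = (\sum_i c i)%N /\
  (kermxpoly T (root_prod c) <= (root_prod (fun i => m i - c i)%N).[T])%MS.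
Proof.
move=> cm; pose q := root_prod (fun i => m i - c i)%N; rewrite -/q.
have pq : root_prod m = root_prod c * q by exact: root_prod_sub cm.
have sub : (q.[T] <= kermxpoly T (root_prod c))%MS.
  rewrite sub_kermxpoly -[_ *m _]/(_ * _) -rmorphM /= mulrC -pq -charT.
  by rewrite Cayley_Hamilton.
have sums : (\sum_i c i + \sum_i (m i - c i))%N = N.
  by rewrite -big_split -sum_mult; apply: eq_bigr => i _; apply: subnKC.
have rq := rank_kermxpoly_le (fun i => m i - c i)%N.
have rp := rank_kermxpoly_le c.
have rT : \rank q.[T] = (N - \rank (kermxpoly T q))%N.
  by rewrite rank_kermxpolyE subKn ?rank_leq_row.
have rs := mxrankS sub.
have rE : \rank (kermxpoly T (root_prod c)) = (\sum_i c i)%N.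
  by apply/eqP; rewrite eqn_leq rp; move: rq rT rs sums; rewrite -/q; lia.
split=> //; rewrite -(geq_leqif (mxrank_leqif_sup sub)) rE rT.
by move: rq sums; rewrite -/q; lia.
Qed.

Lemma mult_le i : (m i <= N)%N.
Proof. by rewrite -sum_mult (bigD1 i) //= leq_addr. Qed.

Lemma XsubC_expr_coprime (c : 'I_s -> nat) i j : j != i ->
  coprimep (('X - (alpha i)%:P) ^+ c i) (('X - (alpha j)%:P) ^+ c j).
Proof.
move=> ji; rewrite coprimep_expr ?coprimep_expl // coprimep_XsubC root_XsubC.
by rewrite (inj_eq alpha_inj).
Qed.

(** The restriction of T to Y is killed by the characteristic polynomial of T,
    and so Y is the sum of the kernels of its coprime factors. *)
Lemma stable_sum_geigen (Y : 'M_N) : stablemx Y T ->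
  (Y <= \sum_i (Y :&: geigenspace T (alpha i)))%MS.
Proof.
move=> Yst; pose B := row_base Y.
have Bfree : row_free B by apply: row_base_free.
have Bst : stablemx B T by rewrite stablemx_row_base.
have full : (1%:M <= kermxpoly (conjmx B T) (root_prod m))%MS.
  rewrite sub_kermxpoly_conjmx // sub_kermxpoly -charT Cayley_Hamilton.
  by rewrite mulmx0.
rewrite kermxpoly_prod in full; last by move=> i j _ _; apply: XsubC_expr_coprime.
have YB : (Y <= 1%:M *m B)%MS by rewrite mul1mx eq_row_base.
apply: submx_trans YB _; apply: submx_trans (submxMr _ full) _.
rewrite sumsmxMr_gen; apply/sumsmx_subP => i _; apply: (sumsmx_sup i) => //.
rewrite genmxE sub_capmx.
have BY : (B <= Y)%MS by rewrite eq_row_base.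
rewrite (submx_trans (submxMl _ _) BY) /=.
apply: submx_trans (kermxpoly_dvd (dvdp_exp2l _ (mult_le i))).
by rewrite -sub_kermxpoly_conjmx.
Qed.

(** The ranks of the Z M^i decrease strictly until they reach 0. *)
Lemma nilpotent_stable (Z M : 'M[K]_N) k : stablemx Z M -> Z *m M ^+ k = 0 ->
  Z *m M ^+ (\rank Z) = 0.
Proof.
move=> Zst Zk.
have step i : (Z *m M ^+ i.+1 <= Z *m M ^+ i)%MS.
  by rewrite exprS mulmxA; apply: submxMr.
have dec i : Z *m M ^+ i = 0 \/ (\rank (Z *m M ^+ i) + i <= \rank Z)%N.
  elim: i => [|i [E|IH]]; first by right; rewrite expr0 mulmx1 addn0.
    by left; rewrite exprSr mulmxA E mul0mx.
  have [lt|ge] := ltnP (\rank (Z *m M ^+ i.+1)) (\rank (Z *m M ^+ i)).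
    by right; move: lt IH; lia.
  left; have sub : (Z *m M ^+ i <= Z *m M ^+ i.+1)%MS.
    by rewrite -(geq_leqif (mxrank_leqif_sup (step i))).
  have iter j : (Z *m M ^+ i.+1 <= Z *m M ^+ (i.+1 + j))%MS.
    elim: j => [|j IHj]; first by rewrite addn0.
    apply: submx_trans IHj _; rewrite {1}addSnnS !exprD !mulmxA.
    exact: submxMr.
  apply/eqP; rewrite -submx0; apply: submx_trans (iter k) _.
  by rewrite addnC exprD mulmxA Zk mul0mx sub0mx.
case: (dec (\rank Z)) => //; rewrite -[X in (_ <= X)%N]add0n leq_add2r leqn0.
by rewrite mxrank_eq0 => /eqP.
Qed.

(** T - alpha_i is nilpotent on the part of Y of dimension d_i in the i-th
    generalized eigenspace, so its power d_i kills this part; by regularity the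
    kernel of this power has dimension at most d_i, and is this part. *)
Lemma stable_kermxpoly (Y : 'M_N) d : stablemx Y T -> (forall i, d i <= m i)%N ->
  (forall i, \rank (Y :&: geigenspace T (alpha i))%MS = d i) ->
  (Y == kermxpoly T (root_prod d))%MS.
Proof.
move=> Yst dm rd.
have E i : (Y :&: geigenspace T (alpha i) ==
    kermxpoly T (('X - (alpha i)%:P) ^+ d i))%MS.
  set Z := (Y :&: _)%MS; pose M := T - (alpha i)%:M.
  have XM k : (('X - (alpha i)%:P) ^+ k).[T] = M ^+ k.
    by rewrite rmorphXn rmorphB /= horner_mx_X horner_mx_C.
  have Zst : stablemx Z M.
    have ZT : stablemx Z T.
      rewrite sub_capmx (submx_trans (submxMr _ (capmxSl _ _)) Yst) /=.
      by apply: submx_trans (submxMr _ (capmxSr _ _)) _; apply: kermxpoly_stable.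
    by rewrite stablemxD // stablemxN stablemxC.
  have Z0 : Z *m M ^+ N = 0.
    by apply/eqP; rewrite -XM -sub_kermxpoly capmxSr.
  have sub : (Z <= kermxpoly T (('X - (alpha i)%:P) ^+ d i))%MS.
    by rewrite sub_kermxpoly XM -(rd i) (nilpotent_stable Zst Z0).
  by rewrite sub /= -(geq_leqif (mxrank_leqif_sup sub)) rd rank_kermxpoly_exp.
have kE := kermxpoly_prod T
  (fun i j (_ : predT i) (_ : predT j) => @XsubC_expr_coprime d i j).
apply/andP; split; rewrite kE.
  apply: submx_trans (stable_sum_geigen Yst) _; apply/sumsmx_subP => i _.
  by apply: (sumsmx_sup i) => //; case/andP: (E i).
apply/sumsmx_subP => i _; case/andP: (E i) => _ /submx_trans; apply.
exact: capmxSl.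
Qed.
End RegularOperator.

Section RegularIsotropic.
Variables (K : fieldType) (n : nat).
Notation N := n.*2.+1.
Variables (A T : 'M[K]_N) (s : nat) (alpha : 'I_s -> K) (m d : 'I_s -> nat).
Hypotheses (Asym : A^T = A) (TA : T *m A = A *m T^T).
Hypothesis charT : char_poly T = root_prod alpha m.
Hypothesis regT : forall i, (\rank (kermx (T - (alpha i)%:M)) <= 1)%N.
Hypothesis dm : forall i, ((d i).*2 < m i)%N.
Notation "p .[T]" := (horner_mx T p) (at level 2, format "p .[T]").

(** Let h be the product of the (x - alpha_j)^d_j and w a vector killed by
    (x - alpha_i) h but not by h; it is an eigenvector for alpha_i modulo ker h.
    It is orthogonal to ker h, which is the image of (f / h)(T): as
    2 d_i < m_i, the polynomial (x - alpha_i) h divides f / h. *)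
Lemma scalar_on_perp (e : {poly K}) (l : K) :
  (perp A (kermxpoly T (root_prod alpha d)) *m (e - l%:P).[T] <=
     kermxpoly T (root_prod alpha d))%MS -> forall i, e.[alpha i] = l.
Proof.
set h := root_prod alpha d; move=> el i.
pose c j := (d j + (j == i))%N.
have cE : root_prod alpha c = h * ('X - (alpha i)%:P).
  rewrite root_prodD; congr (_ * _); rewrite /root_prod (bigD1 i) //= eqxx expr1.
  by rewrite big1 ?mulr1 // => j /negPf ->; rewrite expr0.
have cm j : (c j <= m j - d j)%N.
  by rewrite /c; have := dm j; case: (j == i) => /=; lia.
have cm' j : (c j <= m j)%N by apply: leq_trans (cm j) (leq_subr _ _).
have dm' j : (d j <= m j)%N by have := dm j; lia.
have [rc _] := rank_kermxpoly charT regT cm'.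
have [rd dI] := rank_kermxpoly charT regT dm'.
have /row_subPn [x] : ~~ (kermxpoly T (root_prod alpha c) <= kermxpoly T h)%MS.
  have sc : (\sum_j c j = (\sum_j d j).+1)%N.
    rewrite big_split /= [X in (_ + X)%N](bigD1 i) //= eqxx.
    by rewrite [X in (_ + (_ + X))%N]big1 ?addn1 // => j ji; rewrite (negPf ji).
  by apply/negP => /mxrankS; rewrite rc rd sc ltnn.
set w := row x _ => wh.
have wc : (w <= kermxpoly T (root_prod alpha c))%MS by apply: row_sub.
have wp : (w <= perp A (kermxpoly T h))%MS.
  pose q := root_prod alpha (fun j => m j - d j)%N.
  apply: (@submx_trans _ _ _ _ _ _ (perp A q.[T])).
    rewrite sub_perp -mulmxA -(adjoint_horner TA) mulmxA.
    have := submx_trans wc (kermxpoly_dvd T (root_prod_dvd alpha cm)).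
    by rewrite sub_kermxpoly => /eqP ->; rewrite mul0mx.
  exact: perpS.
have wel : (w *m (e - l%:P).[T] <= kermxpoly T h)%MS.
  by apply: submx_trans (submxMr _ wp) el.
have /dvdpP [r Er] : 'X - (alpha i)%:P %| e - (e.[alpha i])%:P.
  by rewrite dvdp_XsubCl /root !hornerE subrr.
have wr : (w *m (e - (e.[alpha i])%:P).[T] <= kermxpoly T h)%MS.
  have rst := horner_mx_stable r (kermxpoly_stable T h).
  rewrite Er mulrC mul_hornerM; apply: submx_trans (submxMr _ _) rst.
  by rewrite sub_kermxpoly -mul_hornerM mulrC -cE -sub_kermxpoly.
apply/eqP; rewrite -subr_eq0; apply: contraNT wh => el0.
rewrite -(eqmx_scale _ el0) -mul_mx_scalar -(horner_mx_C T) polyCB.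
have -> : (e.[alpha i])%:P - l%:P = (e - l%:P) - (e - (e.[alpha i])%:P) by ring.
by rewrite mul_hornerB addmx_sub // eqmx_opp.
Qed.
End RegularIsotropic.

(** * The largest stable subspace *)

Section StableCore.
Variables (F : fieldType) (N' : nat).
Notation N := N'.+1.
Implicit Types (T X Z : 'M[F]_N).

(** The largest T-stable subspace of X, defined by linear equations so that it is
    compatible with field extensions. *)
Definition stable_core T X : 'M_N :=
  (\bigcap_(j < N) kermx (T ^+ j *m cokermx X))%MS.

Lemma stable_coreP T X k (W : 'M_(k, N)) :
  reflect (forall j : 'I_N, (W *m T ^+ j <= X)%MS) (W <= stable_core T X)%MS.
Proof.
apply: (iffP (sub_bigcapmxP (B_ := fun j : 'I_N => kermx (T ^+ j *m cokermx X)))).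
  by move=> H j; have := H j isT; rewrite sub_kermx mulmxA -submxE.
by move=> H j _; rewrite sub_kermx mulmxA -submxE.
Qed.

Lemma stable_core_horner T X p : (stable_core T X *m horner_mx T p <= X)%MS.
Proof.
set W := stable_core T X.
have HW := stable_coreP T X W (submx_refl _).
rewrite (divp_eq p (char_poly T)) rmorphD rmorphM /= Cayley_Hamilton mulr0 add0r.
set q := _ %% _; have sq : (size q <= N)%N.
  by rewrite -ltnS -(size_char_poly T) ltn_modp monic_neq0 // char_poly_monic.
rewrite -[q]coefK poly_def rmorph_sum mulmx_sumr summx_sub // => j _.
rewrite /= horner_mxZ -scalemxAr scalemx_sub // rmorphXn /= horner_mx_X.
exact: (HW (Ordinal (leq_trans (ltn_ord j) sq))).
Qed.

Lemma stable_core_sub T X : (stable_core T X <= X)%MS.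
Proof. by have := stable_core_horner T X 1; rewrite rmorph1 mulmx1. Qed.

Lemma stable_core_stable T X : stablemx (stable_core T X) T.
Proof.
apply/stable_coreP => j; rewrite -mulmxA -[T *m _]/(T * _) -exprS expmxE.
exact: stable_core_horner.
Qed.

Lemma stable_core_max T X Z : stablemx Z T -> (Z <= X)%MS -> (Z <= stable_core T X)%MS.
Proof.
move=> Zst ZX; apply/stable_coreP => j; apply: submx_trans ZX.
by rewrite expmxE; apply: horner_mx_stable.
Qed.
End StableCore.

Lemma map_stable_core (F K : fieldType) (i : {rmorphism F -> K}) N'
    (T X : 'M[F]_N'.+1) :
  (map_mx i (stable_core T X) :=: stable_core (map_mx i T) (map_mx i X))%MS.
Proof.
rewrite /stable_core; elim/big_rec2: _ => [|j B C _ IH].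
  by rewrite map_mx1; apply: eqmx_refl.
apply: eqmx_trans (map_capmx _ _ _) (cap_eqmx _ IH).
by rewrite map_kermx map_mxM map_cokermx rmorphXn; apply: eqmx_refl.
Qed.

(** * Square roots of 1 acting on the linear spaces *)

Section LinearSpaces.
Variables (F K : fieldType) (i : {rmorphism F -> K}) (n : nat).
Notation N := n.*2.+1.
Variables (A T : 'M[F]_N) (s : nat) (alpha : 'I_s -> K) (m d : 'I_s -> nat).
Hypotheses (Asym : A^T = A) (Aunit : A \in unitmx) (TA : T *m A = A *m T^T).
Hypothesis two_neq0 : (2%:R : F) != 0.
Hypothesis alpha_inj : injective alpha.
Hypothesis charT : map_poly i (char_poly T) = root_prod alpha m.
Hypothesis regT : forall j, (\rank (kermx (map_mx i T - (alpha j)%:M)) <= 1)%N.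
Hypothesis dm : forall j, ((d j).*2 <= m j)%N.
Notation "p .[T]" := (horner_mx T p) (at level 2, format "p .[T]").
Notation L := (in_L i A T alpha d).
Notation Ts := (map_mx i T).
Notation core := (stable_core T).
Implicit Types (X : 'M[F]_N) (e : {poly F}).

Let charTs : char_poly Ts = root_prod alpha m.
Proof. by rewrite -map_char_poly. Qed.

Lemma orthomx_perp X : orthomx idfun A X = perp A X.
Proof. by rewrite /orthomx /perp map_mx_id. Qed.

Lemma in_L_isotropic X : L X -> isotropic_over A T (core X) X.
Proof.
case=> rX; rewrite orthomx_perp => XX XT _; split=> //.
  exact: stable_core_sub.
by move=> Z; apply: stable_core_max.
Qed.

(** This makes the largest stable subspace the same for all members of L. *)
Lemma in_L_core X : L X -> (map_mx i (core X) == kermxpoly Ts (root_prod alpha d))%MS.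
Proof.
case=> _ _ _ dX; apply/eqmxP; apply: eqmx_trans (map_stable_core _ _ _) _; apply/eqmxP.
set Y := stable_core _ _.
have Yst : stablemx Y Ts by apply: stable_core_stable.
have dm' j : (d j <= m j)%N by apply: leq_trans (dm j); rewrite -addnn leq_addr.
apply: (stable_kermxpoly alpha_inj charTs regT Yst dm') => j.
have [W [WU Wst maxW <-]] := dX j.
suff /eqmxP -> : (Y :&: geigenspace Ts (alpha j) == W)%MS by [].
apply/andP; split.
  apply: maxW.
    by rewrite capmxC capmxS // stable_core_sub.
  rewrite sub_capmx (submx_trans (submxMr _ (capmxSl _ _)) Yst) /=.
  by apply: submx_trans (submxMr _ (capmxSr _ _)) _; apply: kermxpoly_stable.
move: WU; rewrite !sub_capmx => /andP [-> WX]; rewrite andbT.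
exact: stable_core_max.
Qed.

Lemma in_L_isotropic2 X X' : L X -> L X' -> isotropic_over A T (core X) X'.
Proof.
move=> LX LX'; have [rX XX XT YX maxY] := in_L_isotropic LX'.
have E : (core X == core X')%MS.
  have [/andP [s1 s2] /andP [s3 s4]] := (in_L_core LX, in_L_core LX').
  apply/andP; split; rewrite -(map_submx i); first exact: submx_trans s1 s4.
  exact: submx_trans s3 s2.
case/andP: E => E1 E2.
split; [exact: rX | exact: XX | exact: XT | exact: submx_trans E1 YX |].
by move=> Z Zst ZX; apply: submx_trans E2; apply: maxY.
Qed.

Lemma in_L_transitive X X' : L X -> L X' ->
  exists2 e, char_poly T %| e ^+ 2 - 1 & (X' == X *m e.[T])%MS.
Proof.
move=> LX LX'; exact: (isotropic_transitive Asym Aunit TA two_neq0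
  (stable_core_stable T X) (in_L_isotropic LX) (in_L_isotropic2 LX LX')).
Qed.

Lemma in_L_act X X' e : char_poly T %| e ^+ 2 - 1 -> (X' == X *m e.[T])%MS ->
  L X -> L X'.
Proof.
move=> fe /eqmxP XE [rX]; rewrite orthomx_perp => XX XT dX.
have E2 := root_of_unity_unit fe; have [Eu _] := mulmx1_unit E2.
have ETC : T *m e.[T] = e.[T] *m T by apply/esym/comm_horner_mx.
have EA : e.[T] *m A *m e.[T]^T = A.
  by rewrite (adjoint_horner TA) -mulmxA -trmx_mul E2 trmx1 mulmx1.
have iso (Z : 'M_N) : (Z <= perp A X)%MS -> (Z *m e.[T] <= perp A X')%MS.
  move=> ZX; rewrite sub_perpC // XE -sub_perpC // sub_perp.
  have -> : Z *m e.[T] *m A *m (X *m e.[T])^T =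
      Z *m (e.[T] *m A *m e.[T]^T) *m X^T by rewrite trmx_mul !mulmxA.
  by rewrite EA -sub_perp.
split.
- by rewrite XE mxrankMfree ?row_free_unit.
- by rewrite orthomx_perp XE; apply: iso.
- rewrite orthomx_perp; apply: (@submx_trans _ _ _ _ _ _ (X *m e.[T] *m T)).
    by apply: submxMr; rewrite XE.
  by rewrite -mulmxA -ETC mulmxA; apply: iso.
move=> j; have [W [WU Wst maxW rW]] := dX j.
pose Es := map_mx i e.[T].
have Es2 : Es *m Es = 1%:M by rewrite -map_mxM E2 map_mx1.
have [Esu _] := mulmx1_unit Es2.
have EsT : Ts *m Es = Es *m Ts by rewrite -!map_mxM ETC.
set U := geigenspace Ts (alpha j).
have UE : (U *m Es <= U)%MS by apply: comm_mx_stable_geigenspace.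
have XsE : (map_mx i X' :=: map_mx i X *m Es)%MS.
  by apply/eqmxP; rewrite -map_mxM !map_submx !XE !submx_refl.
have XsE' : (map_mx i X' *m Es :=: map_mx i X)%MS.
  apply: eqmx_trans (eqmxMr Es XsE) _.
  by rewrite -mulmxA Es2 mulmx1; apply: eqmx_refl.
exists (W *m Es); split.
- move: WU; rewrite !sub_capmx => /andP [WU WX].
  by rewrite (submx_trans (submxMr Es WU) UE) /= XsE submxMr.
- by rewrite -mulmxA -EsT mulmxA submxMr.
- move=> Z ZU Zst; rewrite -[Z]mulmx1 -Es2 mulmxA; apply/submxMr/maxW.
    move: ZU; rewrite !sub_capmx => /andP [ZU ZX].
    apply/andP; split; first exact: submx_trans (submxMr Es ZU) UE.
    by rewrite -XsE' submxMr.
  by rewrite -mulmxA -EsT mulmxA submxMr.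
by rewrite mxrankMfree ?row_free_unit.
Qed.

(** On perp Y / Y the operator e(T) is a scalar l, and every alpha_j is an
    eigenvalue of T; so e takes the value l at all the roots of f, and f divides
    (e - l)(e + l) with e + l prime to f. *)
Lemma in_L_free X e : (forall j, (d j).*2 < m j)%N -> (0 < s)%N -> L X ->
  char_poly T %| e ^+ 2 - 1 -> (X == X *m e.[T])%MS ->
  char_poly T %| e - 1 \/ char_poly T %| e + 1.
Proof.
move=> dlt s_gt0 LX fe Xe; have iso := in_L_isotropic LX.
have [l Hl] := isotropic_stabilizer Asym Aunit TA (stable_core_stable T X) iso Xe.
have CE : (map_mx i (core X) :=: kermxpoly Ts (root_prod alpha d))%MS.
  exact/eqmxP/in_L_core.
have TAs : Ts *m map_mx i A = map_mx i A *m Ts^T by rewrite map_trmx -!map_mxM TA.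
have Asyms : (map_mx i A)^T = map_mx i A by rewrite map_trmx Asym.
have ev : forall j, (map_poly i e).[alpha j] = i l.
  apply: (scalar_on_perp (A := map_mx i A) Asyms TAs charTs regT dlt).
  have : (map_mx i (perp A (core X)) *m map_mx i (e - l%:P).[T] <=
      map_mx i (core X))%MS.
    by rewrite -map_mxM map_submx.
  rewrite CE map_horner_mx rmorphB /= map_polyC /= => H.
  apply: submx_trans H; apply: submxMr.
  rewrite map_kermx map_mxM -map_trmx -/(perp _ _).
  by apply: perpS => //; rewrite CE.
have evroot j : root (map_poly i (char_poly T)) (alpha j).
  rewrite charT /root /root_prod horner_prod (bigD1 j) //= horner_exp hornerXsubC subrr.
  have : (0 < m j)%N by apply: leq_ltn_trans (dlt j).
  by case: (m j) => // k _; rewrite exprS !mul0r.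
have l2 : l ^+ 2 = 1.
  pose j := Ordinal s_gt0; apply: (fmorph_inj i); rewrite rmorphXn rmorph1 /= -(ev j).
  have : root (map_poly i (e ^+ 2 - 1)) (alpha j).
    have /dvdpP [w ->] := fe; rewrite rmorphM /= rootM (evroot j) orbT //.
  by rewrite rmorphB rmorphXn rmorph1 /root !hornerE subr_eq0 => /eqP.
have l0 : l != 0 by apply: contra_eq_neq l2 => ->; rewrite expr0n eq_sym oner_eq0.
have cop : coprimep (char_poly T) (e + l%:P).
  rewrite -(coprimep_map i) charT /root_prod.
  rewrite (@big_morph _ _ (fun p => coprimep p _) true andb) ?big_andE; last first.
  - by rewrite coprime1p.
  - by move=> p q; rewrite coprimepMl.
  apply/forallP => j /=; rewrite coprimep_expl // coprimep_sym coprimep_XsubC.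
  rewrite /root rmorphD /= map_polyC hornerD hornerC ev -rmorphD fmorph_eq0.
  by rewrite -mulr2n -mulr_natl mulf_neq0.
have fl : char_poly T %| e - l%:P.
  rewrite -(Gauss_dvdpl _ cop) (_ : _ * _ = e ^+ 2 - 1) //.
  rewrite -[in RHS](_ : l%:P ^+ 2 = 1); first by ring.
  by rewrite -polyC_exp l2.
have /eqP := l2; rewrite sqrf_eq1 => /orP [] /eqP El; rewrite El in fl; first by left.
by right; move: fl; rewrite polyCN opprK.
Qed.
End LinearSpaces.

(** * The action of the 2-torsion *)

Section Action.
Variables (F K : fieldType) (i : {rmorphism F -> K}) (n : nat).
Notation N := n.*2.+1.
Variables (A T : 'M[F]_N) (s : nat) (alpha : 'I_s -> K) (m d : 'I_s -> nat).
Hypotheses (Asym : A^T = A) (Aunit : A \in unitmx) (TA : T *m A = A *m T^T).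
Hypothesis two_neq0 : (2%:R : F) != 0.
Hypothesis alpha_inj : injective alpha.
Hypothesis s_gt0 : (0 < s)%N.
Hypothesis charT : map_poly i (char_poly T) = root_prod alpha m.
Hypothesis regT : forall j, (\rank (kermx (map_mx i T - (alpha j)%:M)) <= 1)%N.
Hypothesis dm : forall j, ((d j).*2 <= m j)%N.

Notation "p .[T]" := (horner_mx T p) (at level 2, format "p .[T]").
Notation L := (in_L i A T alpha d).
Notation f := (char_poly T).
Notation act := (@J2_act F f n T).
Implicit Types (X Y : 'M[F]_N) (e : {poly %/ f}).
Let eqL := fun X Y : 'M[F]_N => is_true (X == Y)%MS.

Let fmon : f \is monic. Proof. exact: char_poly_monic. Qed.
Let fodd : odd (size f).-1. Proof. by rewrite size_char_poly /= odd_double. Qed.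
Let fsize : (1 < size f)%N. Proof. by rewrite size_char_poly. Qed.

Lemma horner_congr (p q : {poly F}) : f %| p - q -> p.[T] = q.[T].
Proof.
case/dvdpP=> w E; rewrite -(subrK q p) E rmorphD rmorphM /= Cayley_Hamilton.
by rewrite mulr0 add0r.
Qed.

Lemma horner_qpoly (p : {poly F}) : (in_qpoly f p : {poly F}).[T] = p.[T].
Proof. by apply: horner_congr; apply/(in_qpoly_eqP fmon fsize); rewrite in_qpolyK. Qed.

Lemma horner_qpolyM e e' :
  ((e * e' : {poly %/ f}) : {poly F}).[T] = (e : {poly F}).[T] *m (e' : {poly F}).[T].
Proof.
by rewrite -[e in LHS]in_qpolyK -[e' in LHS]in_qpolyK -in_qpolyM horner_qpoly rmorphM.
Qed.

Lemma J2_act_in D X Y : L X -> act D X Y -> L Y.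
Proof.
move=> LX [e [e2 _] YX]; apply: (in_L_act Asym TA _ YX LX).
exact/(qpoly_sqr1P fmon fsize).
Qed.

Lemma J2_act_is_action :
  is_action (@in_J2 F f) (@lin_equiv F f) (div_zero f) (@div_add F f) L eqL act.
Proof.
split.
- move=> D X JD LX; have [e cD] := J2_corresp_exists fmon fodd two_neq0 JD.
  by exists (X *m (e : {poly F}).[T]); exists e; rewrite ?submx_refl.
- by move=> D X Y _; apply: J2_act_in.
- move=> D D' X X' Y Y' _ _ _ _ DD' /eqmxP XX' [e cD /eqmxP YX] [e' cD' /eqmxP YX'].
  rewrite /eqL; apply/eqmxP; apply: eqmx_trans YX _; apply: eqmx_sym.
  apply: eqmx_trans YX' _; apply: eqmx_sym.
  apply: eqmx_trans (eqmxMr _ XX') _.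
  case: (J2_corresp_inj fmon fodd two_neq0 cD cD' DD') => ->; first exact: eqmx_refl.
  have -> : ((- e : {poly %/ f}) : {poly F}).[T] = - (e : {poly F}).[T].
    by rewrite -rmorphN.
  by rewrite mulmxN; apply: eqmx_sym; apply: eqmx_opp.
- move=> X _; exists 1; first exact: (J2_corresp0 fmon fodd two_neq0).
  by rewrite [_.[T]](rmorph1 (horner_mx T)) mulmx1 submx_refl.
move=> D D' X Y Z JD JD' _ [e cD /eqmxP YX] [e' cD' /eqmxP ZY].
exists (e' * e); first exact: (J2_correspM fmon fodd two_neq0).
apply/eqmxP; apply: eqmx_trans ZY (eqmx_trans (eqmxMr _ YX) _).
rewrite horner_qpolyM -mulmxA -[_ *m (e' : {poly F}).[T]]/(_ * _).
by rewrite (comm_horner_mx2 T e e'); apply: eqmx_refl.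
Qed.

Lemma J2_act_transitive : transitive_action (@in_J2 F f) L act.
Proof.
move=> X Y LX LY.
have [e fe YX] :=
  in_L_transitive Asym Aunit TA two_neq0 alpha_inj charT regT dm LX LY.
have e2 : in_qpoly f e ^+ 2 = 1.
  rewrite -rmorphXn /= -(rmorph1 (in_qpoly f)).
  exact/(in_qpoly_eqP fmon fsize).
have [D JD cD] := J2_corresp_of fmon fodd two_neq0 e2.
by exists D => //; exists (in_qpoly f e); rewrite ?horner_qpoly.
Qed.

Lemma J2_act_simply_transitive : (forall j, (d j).*2 < m j)%N ->
  simply_transitive_action (@in_J2 F f) (@lin_equiv F f) L act.
Proof.
move=> dlt; split; first exact: J2_act_transitive.
move=> D D' X Y JD JD' LX _ [e cD YX] [e' cD' YX'].
have [e2 e2'] : e ^+ 2 = 1 /\ e' ^+ 2 = 1 by case: cD cD' => ? _ [].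
apply: (J2_corresp_sign fmon fodd two_neq0 JD JD' cD cD').
have eeT : (e : {poly F}).[T] *m (e : {poly F}).[T] = 1%:M.
  rewrite -horner_qpolyM -expr2 e2; exact: rmorph1.
have Xee : (X == X *m ((e' : {poly F}) * e).[T])%MS.
  rewrite rmorphM /= -[_ * _]/(_ *m _) mulmxA; apply/eqmxP; apply: eqmx_sym.
  apply: eqmx_trans (eqmxMr _ (eqmx_sym (eqmxP YX'))) _.
  apply: eqmx_trans (eqmxMr _ (eqmxP YX)) _.
  by rewrite -mulmxA eeT mulmx1; apply: eqmx_refl.
have fee : f %| ((e' : {poly F}) * e) ^+ 2 - 1.
  apply/(in_qpoly_eqP fmon fsize).
  by rewrite rmorphXn rmorphM /= !in_qpolyK exprMn e2 e2' mulr1 rmorph1.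
have eE : e' = (e' * e) * e by rewrite -mulrA -expr2 e2 mulr1.
have [] := in_L_free Asym Aunit TA two_neq0 alpha_inj charT regT dm dlt s_gt0
  LX fee Xee.
  move/(in_qpoly_eqP fmon fsize); rewrite rmorphM rmorph1 /= !in_qpolyK => E.
  by left; rewrite eE E mul1r.
rewrite -[X in _ + X]opprK => /(in_qpoly_eqP fmon fsize).
rewrite rmorphM rmorphN rmorph1 /= !in_qpolyK => E.
by right; rewrite eE E mulN1r.
Qed.
End Action.

(** * Pencils of quadratic forms *)

Section Pencil.
Variables (k : fieldType) (N : nat).
Implicit Types (Q : 'rV[k]_N -> k).

Lemma polarC Q v w : polar Q v w = polar Q w v.
Proof. by rewrite /polar [v + w]addrC addrAC. Qed.

Lemma polar_sum Q v (c : 'I_N -> k) (w : 'I_N -> 'rV_N) : quadratic_form Q ->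
  polar Q v (\sum_j c j *: w j) = \sum_j c j * polar Q v (w j).
Proof.
case=> _ /(_ v) lin.
have p0 : polar Q v 0 = 0.
  have := lin 1 0 0; rewrite scale1r addr0 mul1r => /esym/eqP.
  by rewrite -subr_eq0 addrK => /eqP.
elim/big_rec2: _ => [|j x y _ <-]; first exact: p0.
exact: lin.
Qed.

Lemma polarE Q v w : quadratic_form Q -> polar Q v w = (v *m gram Q *m w^T) 0 0.
Proof.
move=> qf; rewrite {1}(row_sum_delta w) polar_sum // mxE; apply: eq_bigr => j _.
rewrite mulrC !mxE; congr (_ * _).
rewrite polarC {1}(row_sum_delta v) polar_sum //; apply: eq_bigr => l _.
by rewrite mxE polarC.
Qed.

Lemma gram_sym Q : (gram Q)^T = gram Q.
Proof. by apply/matrixP => a b; rewrite !mxE polarC. Qed.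

Lemma gram_adjoint Q1 Q2 (T : 'M[k]_N) : quadratic_form Q1 ->
  (forall v w, polar Q2 v w = polar Q1 v (w *m T)) -> gram Q2 = gram Q1 *m T^T.
Proof.
move=> qf H; apply/matrixP => a b; rewrite [LHS]mxE H polarE //.
by rewrite trmx_mul mulmxA -(mulmxA _ (gram Q1)) -rowE trmx_delta -colE !mxE.
Qed.
End Pencil.

Lemma pencil_poly_char (k : fieldType) n (A T : 'M[k]_(n.*2.+1)) : \det A != 0 ->
  pencil_poly A (A *m T^T) = char_poly T.
Proof.
move=> A0; rewrite /pencil_poly.
have -> : 'X *: map_mx polyC A - map_mx polyC (A *m T^T) =
    map_mx polyC A *m (char_poly_mx T)^T.
  rewrite /char_poly_mx linearB /= tr_scalar_mx map_trmx mulmxBr mul_mx_scalar.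
  by rewrite map_mxM.
rewrite det_mulmx det_map_mx det_tr -/(char_poly T) mulrA.
have -> : (-1) ^+ n * (\det A)%:P = ((-1) ^+ n * \det A)%:P :> {poly k}.
  by rewrite polyCM polyC_exp polyCN.
rewrite lead_coef_Mmonic ?char_poly_monic // lead_coefC mul_polyC scalerA.
by rewrite mulVf ?scale1r // mulf_neq0 // signr_eq0.
Qed.

Lemma regular_pencil_rank (k : fieldType) N (A T : 'M[k]_N) (l : k) : A \in unitmx ->
  regular_pencil A (A *m T^T) -> root (char_poly T) l ->
  \rank (kermx (T - l%:M)) = 1%N.
Proof.
move=> Au reg rl.
have E : l *: A + (-1) *: (A *m T^T) = A *m (l%:M - T)^T.
  by rewrite linearB /= tr_scalar_mx mulmxBr mul_mx_scalar scaleN1r.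
have := reg l (-1); rewrite E det_mulmx det_tr xpair_eqE oppr_eq0 oner_eq0 andbF.
have -> : \det (l%:M - T) = 0.
  have := rl; rewrite /root /char_poly -horner_evalE -det_map_mx => /eqP <-.
  congr (\det _); apply/matrixP => a b; rewrite !mxE /= horner_evalE !hornerE.
  by rewrite hornerMn hornerX.
rewrite mulr0 => /(_ isT erefl) <-; rewrite !mxrank_ker; congr (_ - _)%N.
rewrite (eqmxMfull _ (_ : row_full A)) ?row_full_unit // mxrank_tr -opprB.
by rewrite mxrank_opp.
Qed.

Theorem theorem1p3
  (k ks : fieldType) (iks : {rmorphism k -> ks}) (n : nat)
  (Q1 Q2 : 'rV[k]_(n.*2.+1) -> k) (T : 'M[k]_(n.*2.+1))
  (r : nat) (alpha : 'I_r.+1 -> ks) (m d : 'I_r.+1 -> nat)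
  (k' ks' : fieldType) (ik' : {rmorphism k -> k'}) (iks' : {rmorphism k' -> ks'})
  (js : {rmorphism ks -> ks'}) :
  (2%:R : k) != 0 ->
  separable_closure iks ->
  (1 <= n)%N ->
  quadratic_form Q1 -> quadratic_form Q2 ->
  \det (gram Q1) != 0 ->
  (forall v w, polar Q2 v w = polar Q1 v (w *m T)) ->
  regular_pencil (map_mx iks (gram Q1)) (map_mx iks (gram Q2)) ->
  let f := pencil_poly (gram Q1) (gram Q2) in
  injective alpha ->
  (forall i, (0 < m i)%N) ->
  map_poly iks f = \prod_(i < r.+1) ('X - (alpha i)%:P) ^+ m i ->
  (forall i, ((d i).*2 <= m i)%N) ->
  separable_closure iks' ->
  (forall x, js (iks x) = iks' (ik' x)) ->
  let f' := map_poly ik' f in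
  let T' := map_mx ik' T in
  let L := in_L iks' (map_mx ik' (gram Q1)) T' (js \o alpha) d in
  let eqL := fun X Y : 'M[k']_(n.*2.+1) => is_true (X == Y)%MS in
  let J2 := @in_J2 k' f' in
  let eqJ := @lin_equiv k' f' in
  let act := @J2_act k' f' n T' in
  let a := #|[set i | (d i).*2 == m i]| in
  [/\ is_action J2 eqJ (@div_zero k' f') (@div_add k' f') L eqL act,
      a = 0%N -> simply_transitive_action J2 eqJ L act
    & (0 < a)%N -> transitive_action J2 L act].
Proof.
move=> two _ _ qf1 _ det1 QT reg f alpha_inj m_gt0 fE dm _ comp.
move=> f' T' L eqL J2 eqJ act a.
have G2 := gram_adjoint qf1 QT.
have G1u : gram Q1 \in unitmx by rewrite unitmxE unitfE.
have fT : f = char_poly T by rewrite /f G2 pencil_poly_char.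
have TG : T *m gram Q1 = gram Q1 *m T^T.
  by rewrite -G2 -[gram Q2]gram_sym G2 trmx_mul trmxK gram_sym.
have fT' : f' = char_poly T' by rewrite /f' fT map_char_poly.
have two' : (2%:R : k') != 0 by rewrite -(rmorph_nat ik') fmorph_eq0.
have Asym : (map_mx ik' (gram Q1))^T = map_mx ik' (gram Q1).
  by rewrite map_trmx gram_sym.
have Aunit : map_mx ik' (gram Q1) \in unitmx by rewrite map_unitmx.
have TA : T' *m map_mx ik' (gram Q1) = map_mx ik' (gram Q1) *m T'^T.
  by rewrite map_trmx -!map_mxM TG.
have jinj : injective (js \o alpha) by move=> x z /fmorph_inj /alpha_inj.
have charT' : map_poly iks' (char_poly T') = root_prod (js \o alpha) m.
  rewrite -fT' /f' -map_poly_comp -(eq_map_poly comp) map_poly_comp fE rmorph_prod.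
  by apply: eq_bigr => j _; rewrite rmorphXn rmorphB /= map_polyX map_polyC.
have regT j : (\rank (kermx (map_mx iks' T' - ((js \o alpha) j)%:M)) <= 1)%N.
  have -> : map_mx iks' T' - ((js \o alpha) j)%:M =
      map_mx js (map_mx iks T - (alpha j)%:M).
    rewrite map_mxB map_scalar_mx -!map_mx_comp; congr (_ - _).
    by apply/matrixP => x z; rewrite !mxE /= comp.
  rewrite -map_kermx mxrank_map.
  rewrite (@regular_pencil_rank _ _ (map_mx iks (gram Q1))) ?map_unitmx //.
    by rewrite map_trmx -map_mxM -G2.
  rewrite -map_char_poly -fT fE /root horner_prod (bigD1 j) //= horner_exp hornerXsubC.
  by rewrite subrr expr0n gtn_eqF // mul0r.
move: f' fT' @J2 @eqJ @act => _ -> J2 eqJ act; split.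
- by apply: J2_act_is_action.
- move=> a0.
  apply: (J2_act_simply_transitive Asym Aunit TA two' jinj _ charT' regT dm) => // j.
  rewrite ltn_neqAle dm andbT; apply/negP => dj.
  by move/eqP: a0; rewrite cards_eq0 => /eqP/setP/(_ j); rewrite !inE dj.
by move=> _; apply: (J2_act_transitive Asym Aunit TA two' jinj charT' regT dm).
Qed.
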